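(* Let $r\in\{0,\dots,d-1\}$, $1\ge\beta_b\ge\beta_\Sigma>0$, $L_b\ge0$, $L_\Sigma>0$, and let $\Sigma$ have maximal rank $r$, i.e. $(\Sigma,b)$ belongs to the null hypothesis $\mathcal H_0$ or $\mathcal H_0^{\mathrm{gap}}$. Then $$\mathbb E[T_{n,h}]\lesssim\begin{cases}h^{\beta_\Sigma}\bigl(L_\Sigma+L_b^2n^{-1}h^{\beta_b}\bigr)&\text{if }(\Sigma,b)\in\mathcal H_0(r,\beta_b,\beta_\Sigma,L_b,L_\Sigma),\\[2pt] h^{2\beta_\Sigma}\bigl(\underline\lambda_r^{-1}L_\Sigma^2+L_b^2n^{-1}\bigr)&\text{if }(\Sigma,b)\in\mathcal H_0^{\mathrm{gap}}(r,\beta_b,\beta_\Sigma,L_b,L_\Sigma,\underline\lambda_r),\ \underline\lambda_r>0.\end{cases}$$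
   Context: Model. On a filtered probability space $(\Omega,\mathcal F,(\mathcal F_t)_{t\ge0},\mathbb P)$ let $dX(t)=b(t)\,dt+\sigma(t)\,dW(t)$, $t\in[0,1]$, be $\mathbb R^d$-valued, where $W$ is an $m$-dimensional standard Brownian motion (with respect to the filtration), $b$ is an adapted $\mathbb R^d$-valued process (measurable, so that the integrals make sense) with $\mathbb E[\int_0^1\|b(t)\|dt]<\infty$, and $\sigma(t)\in\mathbb R^{d\times m}$ is deterministic with $\int_0^1\mathrm{tr}(\sigma(t)\sigma(t)^\top)dt<\infty$. The spot covariance is $\Sigma(t)=\sigma(t)\sigma(t)^\top$. Observations $X(i/n)$, $i=0,\dots,n$. Block length $h\in(0,1]$ with $nh,h^{-1}\in\mathbb N$ (so $n^{-1}\le h$); blocks $I_k=[kh,(k+1)h]$, $k=0,\dots,h^{-1}-1$. $\Delta X_{ik}=X(kh+i/n)-X(kh+(i-1)/n)$, $i=1,\dots,nh$. With $v^{\otimes2}=vv^\top$, the re-centred estimator is $$\hat\Sigma^{kh}=h^{-1}\sum_{i=1}^{nh}\Bigl(\Delta X_{ik}-(nh)^{-1}\sum_{j=1}^{nh}\Delta X_{jk}\Bigr)^{\otimes2}.$$ $\lambda_1(A)\ge\dots\ge\lambda_d(A)$ are the ordered eigenvalues of a symmetric matrix $A$. The test statistic is $T_{n,h}=\sum_{k=0}^{h^{-1}-1}h\,\lambda_{r+1}(\hat\Sigma^{kh})$. Classes. $\mathbb R^{d\times d}_{\mathrm{spd}}$ is the set of symmetric positive semi-definite matrices; $\|\cdot\|$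 is the Euclidean/spectral norm. $\mathcal C^{\beta_\Sigma}(L_\Sigma)$ is the set of $\Sigma:[0,1]\to\mathbb R^{d\times d}_{\mathrm{spd}}$ with $\|\Sigma(t)-\Sigma(s)\|\le L_\Sigma|t-s|^{\beta_\Sigma}$ for all $s,t\in[0,1]$. $\mathcal H^{\beta_b}(L_b)$ is the class of adapted $\mathbb R^d$-valued processes $b$ on $[0,1]$ with $\mathbb E[\int_0^1\|b(t)\|dt]<\infty$ and $\mathbb E[\|b(s)-b(t)\|^4]^{1/4}\le L_b|s-t|^{\beta_b}$ for all $0\le t\le s\le1$. $\mathcal H_0(r,\beta_b,\beta_\Sigma,L_b,L_\Sigma)$ is the set of $(\Sigma,b)\in C([0,1];\mathbb R^{d\times d}_{\mathrm{spd}})\times\mathcal H^{\beta_b}(L_b)$ with $\sup_{t\in[0,1]}\mathrm{rank}(\Sigma(t))\le r$ and $\Sigma\in\mathcal C^{\beta_\Sigma}(L_\Sigma)$. $\mathcal H_0^{\mathrm{gap}}(r,\beta_b,\beta_\Sigma,L_b,L_\Sigma,\underline\lambda_r)$ is the subset of those $(\Sigma,b)$ with additionally $\inf_{t\in[0,1]}\lambda_r(\Sigma(t))\ge\underline\lambda_r$ (this condition is void if $r=0$). $A\lesssim B$ means $A\le KB$ with a constant $K>0$ depending only on the dimension $d$ (not on $n$, $h$ or $(\Sigma,b)$). *)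

(* Defs.v *)
From HB Require Import structures.
From mathcomp Require Import all_boot all_order all_algebra.
From mathcomp Require Import all_classical all_reals all_analysis.

Set Implicit Arguments.
Unset Strict Implicit.
Unset Printing Implicit Defensive.

Import Order.TTheory GRing.Theory Num.Theory.
Import numFieldNormedType.Exports.

Local Open Scope classical_set_scope.
Local Open Scope ring_scope.

Section LinearAlgebra.
Context {R : realType}.

(* The library norm on matrices is the maximum of the entries, hence the
   following two norms. *)
Definition enorm {d : nat} (v : 'cV[R]_d) : R :=
  Num.sqrt (\sum_(i < d) v i ord0 ^+ 2).

Definition spectral_norm {d : nat} (A : 'M[R]_d) : R :=
  sup [set enorm (A *m v) | v in [set v : 'cV[R]_d | enorm v <= 1]].

Definition psd {d : nat} (A : 'M[R]_d) : Prop :=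
  A^T = A /\ forall v : 'cV[R]_d, 0 <= (v^T *m A *m v) ord0 ord0.

(* Eigenvalues with multiplicity, in decreasing order.  The sequence exists and
   is unique for symmetric A; it is [::] if the characteristic polynomial of A
   does not split over R. *)
Definition ordered_eigenvalues {d : nat} (A : 'M[R]_d) : seq R :=
  xget [::] [set s : seq R | sorted (fun x y => y <= x) s /\
                             char_poly A = \prod_(x <- s) ('X - x%:P)].

(* Indexed from 1: eigval 1 A is the largest eigenvalue and eigval d A the
   smallest one; eigval 0 A is meaningless. *)
Definition eigval {d : nat} (k : nat) (A : 'M[R]_d) : R :=
  nth 0 (ordered_eigenvalues A) k.-1.

Definition tensor2 {d : nat} (v : 'cV[R]_d) : 'M[R]_d := v *m v^T.

End LinearAlgebra.

Section Processes.
Context {R : realType} {disp : measure_display} {Omega : measurableType disp}.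
Implicit Types (P : probability Omega R) (F : R -> set (set Omega)).

(* Only the indices t >= 0 matter. *)
Definition filtration F : Prop :=
  [/\ forall t, 0 <= t -> sigma_algebra [set: Omega] (F t),
      forall t, 0 <= t -> F t `<=` measurable &
      forall s t, 0 <= s -> s <= t -> F s `<=` F t].

(* The sigma-algebra generated by a random vector *)
Definition sigma_vec {d : nat} (V : Omega -> 'cV[R]_d) : set (set Omega) :=
  <<s [set A | exists (i : 'I_d) (B : set R),
         measurable B /\ A = [set w | B (V w i ord0)]] >>.

Definition measurable_wrt {d : nat} (G : set (set Omega))
    (V : Omega -> 'cV[R]_d) : Prop := sigma_vec V `<=` G.

Definition indep P (G H : set (set Omega)) : Prop :=
  forall A B, G A -> H B -> P (A `&` B) = (P A * P B)%E.

(* The law of V is the normal distribution on R^m with mean 0 and covariance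
   v times the identity, v > 0: a product measure, hence determined by its
   values on boxes (normal_prob takes a standard deviation). *)
Definition isotropic_normal P {m : nat} (v : R) (V : Omega -> 'cV[R]_m) : Prop :=
  forall B : 'I_m -> set R, (forall j, measurable (B j)) ->
    P [set w | forall j, B j (V w j ord0)] =
    (\prod_(j < m) normal_prob 0 (Num.sqrt v) (B j))%E.

Definition brownian_motion P F {m : nat} (W : R -> Omega -> 'cV[R]_m) : Prop :=
  [/\ forall t, 0 <= t -> measurable_wrt (F t) (W t),
      {ae P, forall w, W 0 w = 0},
      {ae P, forall w, {within `[0, +oo[, continuous (fun t => W t w)}},
      forall s t, 0 <= s -> s < t ->
        isotropic_normal P (t - s) (fun w => W t w - W s w) &
      forall s t, 0 <= s -> s < t ->
        indep P (F s) (sigma_vec (fun w => W t w - W s w))].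

Definition step_fun {d m : nat} (N : nat) (tau : nat -> R)
    (v : nat -> 'M[R]_(d, m)) (s : R) : 'M[R]_(d, m) :=
  \sum_(k < N) (\1_(`]tau k, tau k.+1]) s : R) *: v k.

Definition step_int {d m : nat} (W : R -> Omega -> 'cV[R]_m) (N : nat)
    (tau : nat -> R) (v : nat -> 'M[R]_(d, m)) (w : Omega) : 'cV[R]_d :=
  \sum_(k < N) v k *m (W (tau k.+1) w - W (tau k) w).

(* I is (a version of) the Ito integral of the deterministic integrand sigma
   against W over [0, t]: the L2(P)-limit of the integrals of step functions
   which converge to sigma in L2([0, t]). *)
Definition ito_integral P {d m : nat} (W : R -> Omega -> 'cV[R]_m) (t : R)
    (sigma : R -> 'M[R]_(d, m)) (I : Omega -> 'cV[R]_d) : Prop :=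
  measurable_wrt measurable I /\
  exists (N : nat -> nat) (tau : nat -> nat -> R)
         (v : nat -> nat -> 'M[R]_(d, m)),
  [/\ forall l k, (k < N l)%N ->
        [/\ 0 <= tau l k, tau l k <= tau l k.+1 & tau l k.+1 <= t],
      (fun l => (\int[lebesgue_measure]_(s in `[0%R, t])
         (let D := step_fun (N l) (tau l) (v l) s - sigma s in
          \tr (D *m D^T))%:E)%E) @ \oo --> 0%E &
      (fun l => ('E_P[fun w =>
         (enorm (I w - step_int W (N l) (tau l) (v l) w) ^+ 2)%R])%E)
        @ \oo --> 0%E].

Definition admissible_drift P F {d : nat} (b : R -> Omega -> 'cV[R]_d) : Prop :=
  [/\ forall t, 0 <= t <= 1 -> measurable_wrt (F t) (b t),
      forall i : 'I_d, measurable_fun ((`[0%R, 1%R] : set (measurableTypeR R)) `*` [set: Omega])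
        (fun z : measurableTypeR R * Omega => b z.1 z.2 i ord0) &
      (\int[P]_w \int[lebesgue_measure]_(t in `[0%R, 1%R])
         (enorm (b t w))%:E < +oo)%E].

Definition admissible_volatility {d m : nat} (sigma : R -> 'M[R]_(d, m)) : Prop :=
  (forall i j, measurable_fun (`[0%R, 1%R] : set R) (fun t : R => sigma t i j)) /\
  (\int[lebesgue_measure]_(t in `[0%R, 1%R])
     (\tr (sigma t *m (sigma t)^T))%:E < +oo)%E.

(* dX(t) = b(t) dt + sigma(t) dW(t) on [0, 1], in integrated form; X need not be
   the continuous version, only finitely many X(t) are observed. *)
Definition ito_process P {d m : nat} (W : R -> Omega -> 'cV[R]_m)
    (b : R -> Omega -> 'cV[R]_d) (sigma : R -> 'M[R]_(d, m))
    (X : R -> Omega -> 'cV[R]_d) : Prop :=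
  forall t, 0 <= t <= 1 ->
    measurable_wrt measurable (X t) /\
    exists2 I : Omega -> 'cV[R]_d, ito_integral P W t sigma I &
      {ae P, forall w, X t w = X 0 w
         + \col_i (\int[lebesgue_measure]_(s in `[0%R, t]) b s w i ord0)
         + I w}.

End Processes.

Section Statistic.
Context {R : realType} {Omega : Type} {d : nat}.
Variables (X : R -> Omega -> 'cV[R]_d) (n : nat) (h : R).

(* The natural number n h, when n h is one *)
Definition block_size : nat := Num.truncn (n%:R * h).

Definition incr (k i : nat) (w : Omega) : 'cV[R]_d :=
  X (k%:R * h + i%:R / n%:R) w - X (k%:R * h + i.-1%:R / n%:R) w.

Definition Sigma_hat (k : nat) (w : Omega) : 'M[R]_d :=
  h^-1 *: \sum_(1 <= i < block_size.+1)
    tensor2 (incr k i w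
             - (n%:R * h)^-1 *: \sum_(1 <= j < block_size.+1) incr k j w).

Definition test_stat (r : nat) (w : Omega) : R :=
  \sum_(0 <= k < Num.truncn h^-1) h * eigval r.+1 (Sigma_hat k w).

End Statistic.

Section Hypotheses.
Context {R : realType} {disp : measure_display} {Omega : measurableType disp}.
Variables (P : probability Omega R) (F : R -> set (set Omega)).

Definition spot_cov {d m : nat} (sigma : R -> 'M[R]_(d, m)) (t : R) : 'M[R]_d :=
  sigma t *m (sigma t)^T.

Definition holder_cov {d : nat} (beta L : R) (Sigma : R -> 'M[R]_d) : Prop :=
  (forall t, 0 <= t <= 1 -> psd (Sigma t)) /\
  forall s t, 0 <= s <= 1 -> 0 <= t <= 1 ->
    spectral_norm (Sigma t - Sigma s) <= L * `|t - s| `^ beta.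

Definition holder_drift {d : nat} (beta L : R)
    (b : R -> Omega -> 'cV[R]_d) : Prop :=
  admissible_drift P F b /\
  forall s t, 0 <= t -> t <= s -> s <= 1 ->
    ('N[P]_4%:E[(fun w => (enorm (b s w - b t w))%:E)]
      <= (L * `|s - t| `^ beta)%:E)%E.

Definition H0 {d : nat} (r : nat) (beta_b beta_Sigma L_b L_Sigma : R)
    (Sigma : R -> 'M[R]_d) (b : R -> Omega -> 'cV[R]_d) : Prop :=
  [/\ {within `[0, 1], continuous Sigma},
      holder_drift beta_b L_b b,
      forall t, 0 <= t <= 1 -> (\rank (Sigma t) <= r)%N &
      holder_cov beta_Sigma L_Sigma Sigma].

Definition H0_gap {d : nat} (r : nat) (beta_b beta_Sigma L_b L_Sigma lam : R)
    (Sigma : R -> 'M[R]_d) (b : R -> Omega -> 'cV[R]_d) : Prop :=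
  H0 r beta_b beta_Sigma L_b L_Sigma Sigma b /\
  ((0 < r)%N -> forall t, 0 <= t <= 1 -> lam <= eigval r (Sigma t)).

End Hypotheses.

(* Main.v *)
(* On a block starting at t0, project onto the kernel of Sigma(t0), which has
   dimension at least d - r: by Courant-Fischer, the (r+1)-st eigenvalue of the
   block estimator is at most the sum of the squared projected, re-centred
   increments divided by h.  For unit v in that kernel, v^T Sigma(s) v is at most
   L_Sigma h^beta_Sigma; under the spectral gap Sigma(s)^2 >= lam Sigma(s), and it
   is at most |Sigma(s) v|^2 / lam <= (L_Sigma h^beta_Sigma)^2 / lam.  The Ito
   isometry turns this into a bound for the martingale part.  Re-centring allows
   the subtraction of any constant, in particular b(t0) / n, so that only the
   oscillation of the drift over the block remains. *)

From HB Require Import structures.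
Require Import Defs.
From mathcomp Require Import all_boot all_order all_algebra.
From mathcomp Require Import all_classical all_reals all_analysis.
From mathcomp Require Import measurable_realfun ring lra.

Import Order.TTheory GRing.Theory Num.Theory.
Import numFieldNormedType.Exports.

Local Open Scope classical_set_scope.
Local Open Scope ring_scope.

(** * Euclidean norms, quadratic forms, the kernel projection and eigenvalue bounds *)

Section SquaredNorm.
Context {R : realType}.

(** Two obstacles shape the development. The stochastic integrals at the two ends of an increment
    are only known as L2-limits of step integrals over unrelated partitions, so their difference is
    not itself given as an integral over the increment. The isometry is therefore a bilinear
    relation, and the difference is estimated on all of [[0, c]], where the part before [a] cancels
    up to approximation errors. Secondly, the eigenvalues come from a choice operator with default
    [[::]], so the statistic is handled only through a dominating random variable that is polynomial
    in the increments and in b(t0). All probabilistic estimates are scalar: the projection Q is read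
    column by column, each column being a kernel vector of norm at most 1, at the price of a factor
    d. The Gaussian second moment stays symbolic. The constant 12 = 2 * 3 * 2 collects three
    elementary inequalities: splitting off the drift, inserting two step approximations, and
    comparing a step function with [sigma]. *)

Definition sqn {d} (v : 'cV[R]_d) : R := \sum_i v i ord0 ^+ 2.

Definition qform {d} (A : 'M[R]_d) (v : 'cV[R]_d) : R :=
  (v^T *m A *m v) ord0 ord0.

Lemma dotE {d} (u v : 'cV[R]_d) :
  (u^T *m v) ord0 ord0 = \sum_i u i ord0 * v i ord0.
Proof. by rewrite mxE; apply: eq_bigr => i _; rewrite mxE. Qed.

Lemma sqnE {d} (v : 'cV[R]_d) : sqn v = (v^T *m v) ord0 ord0.
Proof. by rewrite dotE. Qed.

Lemma mx11_tr (A : 'M[R]_1) : A^T = A.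
Proof. by apply/matrixP => i j; rewrite mxE !ord1. Qed.

Lemma sqn_mx {d} (v : 'cV[R]_d) : v^T *m v = (sqn v)%:M.
Proof. by rewrite sqnE -mx11_scalar. Qed.

Lemma sqn_ge0 {d} (v : 'cV[R]_d) : 0 <= sqn v.
Proof. by apply: sumr_ge0 => i _; rewrite sqr_ge0. Qed.

Lemma sqn_eq0 {d} (v : 'cV[R]_d) : (sqn v == 0) = (v == 0).
Proof.
apply/eqP/eqP => [|->]; last first.
  by rewrite /sqn big1 // => i _; rewrite mxE expr0n.
move=> /eqP; rewrite psumr_eq0 => [|i _]; last exact: sqr_ge0.
move=> /allP H; apply/colP => i; rewrite mxE.
by have := H i (mem_index_enum _); rewrite /= sqrf_eq0 => /eqP.
Qed.

Lemma sqn_gt0 {d} (v : 'cV[R]_d) : (0 < sqn v) = (v != 0).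
Proof. by rewrite lt0r sqn_ge0 andbT sqn_eq0. Qed.

Lemma sqnZ {d} a (v : 'cV[R]_d) : sqn (a *: v) = a ^+ 2 * sqn v.
Proof. by rewrite /sqn mulr_sumr; apply: eq_bigr => i _; rewrite mxE exprMn. Qed.

Lemma enorm_sqr {d} (v : 'cV[R]_d) : enorm v ^+ 2 = sqn v.
Proof. by rewrite sqr_sqrtr // sqn_ge0. Qed.

Lemma enorm_ge0 {d} (v : 'cV[R]_d) : 0 <= enorm v.
Proof. exact: sqrtr_ge0. Qed.

(** Lagrange's identity: twice the right side minus the left side is the double sum of the squares
    of [a i * b j - a j * b i]. *)
Lemma sum_cauchy_schwarz (I : finType) (a b : I -> R) :
  (\sum_i a i * b i) ^+ 2 <= (\sum_i a i ^+ 2) * (\sum_i b i ^+ 2).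
Proof.
have H : 0 <= \sum_i \sum_j (a i * b j - a j * b i) ^+ 2.
  by do 2! (apply: sumr_ge0 => ? _); rewrite sqr_ge0.
have E : \sum_i \sum_j (a i * b j - a j * b i) ^+ 2 =
   (\sum_i a i ^+ 2) * (\sum_i b i ^+ 2) *+ 2 -
   ((\sum_i a i * b i) ^+ 2) *+ 2.
  transitivity (\sum_i \sum_j (a i ^+ 2 * b j ^+ 2)
     + \sum_i \sum_j (a j ^+ 2 * b i ^+ 2)
     - (\sum_i \sum_j (a i * b i) * (a j * b j)) *+ 2).
    rewrite -sumrMnl -big_split /= -sumrB; apply: eq_bigr => i _.
    rewrite -sumrMnl -big_split /= -sumrB; apply: eq_bigr => j _.
    ring.
  rewrite [X in _ + X - _]exchange_big /= expr2 !mulr_suml mulr2n.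
  by congr (_ + _ - _ *+ 2); apply: eq_bigr => i _; rewrite mulr_sumr.
by move: H; rewrite E -mulrnBl pmulrn_lge0 // subr_ge0.
Qed.

Lemma sqnD_le {d} (u v : 'cV[R]_d) : sqn (u + v) <= 2 * sqn u + 2 * sqn v.
Proof.
rewrite /sqn !mulr_sumr -big_split /=; apply: ler_sum => i _; rewrite mxE.
by have := sqr_ge0 (u i ord0 - v i ord0); rewrite sqrrB sqrrD; lra.
Qed.

Lemma sqnN {d} (v : 'cV[R]_d) : sqn (- v) = sqn v.
Proof. by apply: eq_bigr => i _; rewrite mxE sqrrN. Qed.

Lemma tr_gram {d m} (D : 'M[R]_(d, m)) :
  \tr (D *m D^T) = \sum_i \sum_j D i j ^+ 2.
Proof. by apply: eq_bigr => i _; rewrite mxE; apply: eq_bigr => j _; rewrite mxE. Qed.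

Lemma dot_cauchy_schwarz {d} (u v : 'cV[R]_d) :
  (u^T *m v) ord0 ord0 ^+ 2 <= sqn u * sqn v.
Proof. by rewrite dotE; exact: sum_cauchy_schwarz. Qed.

Lemma sqn_mulmx_le {p d} (A : 'M[R]_(p, d)) (v : 'cV[R]_d) :
  sqn (A *m v) <= (\sum_i \sum_j A i j ^+ 2) * sqn v.
Proof.
rewrite mulr_suml; apply: ler_sum => i _.
by rewrite mxE; exact: sum_cauchy_schwarz.
Qed.

Lemma enorm_mulmx_le {d} (A : 'M[R]_d) (v : 'cV[R]_d) :
  enorm v <= 1 -> enorm (A *m v) <= spectral_norm A.
Proof.
move=> v1; apply: ub_le_sup; last by exists v.
(* The Frobenius norm shows that the set is bounded, so that [sup] really dominates its members. *)
exists (Num.sqrt (\sum_i \sum_j A i j ^+ 2)) => _ [u /= u1 <-].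
rewrite ler_wsqrtr // (le_trans (sqn_mulmx_le A u)) //.
rewrite ler_piMr //; first by do 2! (apply: sumr_ge0 => ? _); rewrite sqr_ge0.
by rewrite -enorm_sqr expr_le1 // enorm_ge0.
Qed.

(** The trace is the squared Frobenius norm, the distance used in [ito_integral]; it controls the
    error in every direction q. *)
Lemma sqn_trmul_le {d m} (D : 'M[R]_(d, m)) q : sqn q <= 1 ->
  sqn (D^T *m q) <= \tr (D *m D^T).
Proof.
move=> q1; apply: le_trans (sqn_mulmx_le _ _) _; rewrite tr_gram exchange_big /=.
under eq_bigr do under eq_bigr do rewrite mxE.
rewrite exchange_big /= ler_piMr //.
by do 2! (apply: sumr_ge0 => ? _); rewrite sqr_ge0.
Qed.

Lemma qformE {d} (A : 'M[R]_d) v :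
  qform A v = (v^T *m (A *m v)) ord0 ord0.
Proof. by rewrite /qform mulmxA. Qed.

Lemma qformB {d} (A B : 'M[R]_d) v : qform (A - B) v = qform A v - qform B v.
Proof. by rewrite /qform mulmxBr mulmxBl !mxE. Qed.

Lemma qform_gram {d m} (A : 'M[R]_(d, m)) v :
  qform (A *m A^T) v = sqn (A^T *m v).
Proof. by rewrite sqnE trmx_mul trmxK /qform !mulmxA. Qed.

Lemma qform_tensor2 {d} (y v : 'cV[R]_d) :
  qform (tensor2 y) v = (y^T *m v) ord0 ord0 ^+ 2.
Proof.
rewrite /qform /tensor2 mulmxA -mulmxA mxE big_ord1 expr2; congr (_ * _).
by rewrite -[v^T *m y]mx11_tr trmx_mul trmxK.
Qed.

(* For unit vectors in the kernel of A, the form of B only sees A - B. *)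
Lemma qform_ker_le {d} (A B : 'M[R]_d) v L : enorm v <= 1 -> A *m v = 0 ->
  spectral_norm (B - A) <= L -> qform B v <= L.
Proof.
move=> v1 Av BA.
have -> : qform B v = qform (B - A) v.
  by rewrite qformB [qform A v]qformE Av mulmx0 mxE subr0.
apply: le_trans BA; apply: le_trans (enorm_mulmx_le (B - A) v v1).
rewrite qformE; apply: le_trans (ler_norm _) _.
rewrite -(ler_pXn2r (n := 2)) ?nnegrE ?enorm_ge0 //.
rewrite real_normK ?num_real // (le_trans (dot_cauchy_schwarz _ _)) //.
rewrite enorm_sqr ler_piMl ?sqn_ge0 //.
by rewrite -enorm_sqr expr_le1 // enorm_ge0.
Qed.

(** Counterpart of [qform_ker_le] for the gap case, where [eigval_gap] bounds the form by the
    squared length of [B *m v]. *)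
Lemma sqn_ker_le {d} (A B : 'M[R]_d) v L : enorm v <= 1 -> A *m v = 0 ->
  spectral_norm (B - A) <= L -> sqn (B *m v) <= L ^+ 2.
Proof.
move=> v1 Av BA.
have -> : B *m v = (B - A) *m v by rewrite mulmxBl Av subr0.
rewrite -enorm_sqr.
have H := le_trans (enorm_mulmx_le (B - A) v v1) BA.
by rewrite ler_pXn2r ?nnegrE ?enorm_ge0 // (le_trans (enorm_ge0 _) H).
Qed.

(* The orthogonal projection onto the kernel, written with a basis B of the row
   space: B B^T is invertible because x B B^T = 0 forces |x B|^2 = 0. *)
Lemma ker_projection {d} (S : 'M[R]_d) : exists Q : 'M[R]_d,
  [/\ Q^T = Q, Q *m Q = Q, S *m Q = 0 &
      forall v : 'cV[R]_d, S *m v = 0 -> Q *m v = v].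
Proof.
set B := row_base S.
have BBu : (B *m B^T) \in unitmx.
  rewrite -row_free_unit -kermx_eq0; apply/eqP/row_matrixP => i.
  rewrite row0; set x := row i _.
  have xB : x *m (B *m B^T) = 0 by apply/sub_kermxP; exact: row_sub.
  have : (x *m B)^T = 0.
    apply/eqP; rewrite -sqn_eq0 sqnE trmxK trmx_mul mulmxA -(mulmxA x) xB.
    by rewrite mul0mx mxE.
  move=> /(congr1 trmx); rewrite trmxK trmx0 => xB0.
  by apply: (row_free_inj (row_base_free S)); rewrite mul0mx.
(* S and its row basis B are left multiples of each other, hence have the same kernel: [B *m Q = 0]
   passes to S, and [S *m v = 0] passes to B. *)
have SB : S = S *m pinvmx B *m B by rewrite mulmxKpV // eq_row_base.
have BS : B = B *m pinvmx S *m S by rewrite mulmxKpV // eq_row_base.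
exists (1%:M - B^T *m invmx (B *m B^T) *m B).
clearbody B.
have BQ : B *m (1%:M - B^T *m invmx (B *m B^T) *m B) = 0.
  by rewrite mulmxBr mulmx1 !mulmxA mulmxV // mul1mx subrr.
split.
- rewrite linearB /= trmx1 !trmx_mul trmxK trmx_inv trmx_mul trmxK.
  by rewrite !mulmxA.
- by rewrite [LHS]mulmxBl mul1mx -[X in _ - X]mulmxA BQ mulmx0 subr0.
- set Q := 1%:M - _ in BQ *.
  have -> : S *m Q = S *m pinvmx B *m B *m Q by congr (_ *m _).
  by rewrite -mulmxA BQ mulmx0.
- move=> v Sv; rewrite mulmxBl mul1mx -[X in _ - X]mulmxA.
  have -> : B *m v = B *m pinvmx S *m S *m v by congr (_ *m _).
  by rewrite -[B *m _ *m S *m v]mulmxA Sv !mulmx0 subr0.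
Qed.


(** The reflection in the hyperplane orthogonal to w = u - e, with e the first basis vector. The
    case u = e is separate because then w = 0. *)
Lemma householder {d} (u : 'cV[R]_d.+1) : sqn u = 1 ->
  exists H : 'M[R]_d.+1, [/\ H^T = H, H *m H = 1%:M & H *m delta_mx 0 0 = u].
Proof.
move=> u1; have [e eE] : {e : 'cV[R]_d.+1 | e = delta_mx 0 0} by eexists.
rewrite -eE; have [->|ue] := eqVneq u e.
  by exists 1%:M; rewrite trmx1 !mul1mx.
have [w wE] : {w | w = u - e} by eexists.
have w0 : sqn w != 0 by rewrite sqn_eq0 wE subr_eq0.
have eTe : e^T *m e = 1%:M.
  rewrite eE trmx_delta mul_delta_mx; apply/matrixP => i j.
  by rewrite !ord1 !mxE.
have uTu : u^T *m u = 1%:M by rewrite sqn_mx u1.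
have wT : w^T = u^T - e^T by rewrite wE linearB.
(* Here u and e having the same length enters; it makes the reflection send e to exactly e + w =
   u. *)
have wTe2 : (w^T *m e) *+ 2 = - (w^T *m w).
  have -> : w^T *m e = u^T *m e - 1%:M by rewrite wT mulmxBl eTe.
  rewrite wT wE mulmxBr !mulmxBl uTu eTe.
  have -> : e^T *m u = u^T *m e by rewrite -[RHS]mx11_tr trmx_mul trmxK.
  by move: (u^T *m e) => p; apply/matrixP => i j; rewrite mulr2n !mxE; ring.
set H := 1%:M - (2 / sqn w) *: (w *m w^T).
exists H; split.
- by rewrite /H linearB /= linearZ /= trmx1 trmx_mul trmxK.
- rewrite /H mulmxBr mulmx1 mulmxBl mul1mx -scalemxAl -scalemxAr.
  rewrite (mulmxA (w *m w^T)) -(mulmxA w) sqn_mx mul_mx_scalar -scalemxAl.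
  rewrite !scalerA; set c := 2 / _. have -> : c * c * sqn w = 2 * c.
    by rewrite /c; field.
  by rewrite mulr_natl mulr2n scalerDl opprB addrA; apply/matrixP => i j;
     rewrite !mxE; ring.
- rewrite /H mulmxBl mul1mx -scalemxAl -mulmxA.
  have -> : w^T *m e = (- (sqn w / 2))%:M.
    have -> : w^T *m e = 2^-1 *: ((w^T *m e) *+ 2).
      by rewrite -[(_ *m _) *+ 2]scaler_nat scalerA mulVf ?scale1r // pnatr_eq0.
    by rewrite wTe2 sqn_mx -raddfN scale_scalar_mx mulrN mulrC.
  rewrite mul_mx_scalar scalerA mulrN [_ / _ * _](_ : _ = 1); last by field.
  by rewrite scaleN1r opprK addrC wE subrK.
Qed.

(* Deflation: a root of the characteristic polynomial gives a unit eigenvector,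
   which a Householder reflection moves to the first basis vector. *)
Lemma sym_split_diagonalizable {d} (A : 'M[R]_d) (s : seq R) :
  A^T = A -> char_poly A = \prod_(x <- s) ('X - x%:P) ->
  size s = d /\
  exists U : 'M[R]_d, U^T *m U = 1%:M /\
    U^T *m A *m U = diag_mx (\row_i nth 0 s i).
Proof.
move=> AT cA; have ss : size s = d.
  by have := size_char_poly A; rewrite cA size_prod_XsubC => -[].
split=> //; elim: d A s AT cA ss => [|d IH] A s AT cA ss.
  by exists 1%:M; split; apply/matrixP => -[].
case: s cA ss => // x s cA [ss].
have : eigenvalue A x by rewrite eigenvalue_root_char cA big_cons rootM root_XsubC eqxx.
move=> /eigenvalueP[v vA v0].
have vT : A *m v^T = x *: v^T by rewrite -{1}AT -trmx_mul vA linearZ.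
have n0 : 0 < sqn (v^T) by rewrite sqn_gt0 -trmx0 (inj_eq trmx_inj).
have c0 : Num.sqrt (sqn (v^T)) != 0 by rewrite gt_eqF // sqrtr_gt0.
set u := (Num.sqrt (sqn (v^T)))^-1 *: v^T.
have u1 : sqn u = 1 by rewrite sqnZ exprVn sqr_sqrtr ?ltW // mulVf // gt_eqF.
have Au : A *m u = x *: u by rewrite -scalemxAr vT scalerA mulrC -scalerA.
have [H [HT HH He]] := householder u u1.
have [B BE] : {B : 'M[R]_(1 + d) | B = H *m A *m H} by eexists.
have BT : B^T = B by rewrite BE !trmx_mul HT AT mulmxA.
have Be : B *m delta_mx 0 0 = x *: (delta_mx 0 0 : 'cV[R]_d.+1).
  by rewrite BE -!mulmxA He Au -scalemxAr -He mulmxA HH mul1mx.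
have Bi i : B i ord0 = x * (i == ord0)%:R.
  have := congr1 (fun M : 'cV[R]_d.+1 => M i ord0) Be.
  by rewrite -colE !mxE andbT.
have Bj j : B ord0 j = x * (j == ord0)%:R by rewrite -Bi -{1}BT mxE.
have l0 : lshift d (ord0 : 'I_1) = (@ord0 d) by exact/val_inj.
(* The first column of B is x times the first basis vector; by symmetry the first row is as well, so
   B is block diagonal. *)
have EB : B = block_mx x%:M 0 0 (drsubmx B).
  rewrite -{1}[B]submxK; congr block_mx; apply/matrixP => i j; rewrite !mxE.
  - rewrite (ord1 i) (ord1 j) l0 ?Bi ?eqxx ?mulr1 //.
  - by rewrite (ord1 i) ?(ord1 j) l0 ?Bj ?mulr0 //.
  - by rewrite (ord1 j) l0 ?Bi ?mulr0 //.
have cB : char_poly B = char_poly A.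
  rewrite /char_poly /char_poly_mx.
  have HH' : map_mx polyC H *m map_mx polyC H = 1%:M.
    by rewrite -map_mxM HH map_mx1.
  have -> : 'X%:M - map_mx polyC B =
      map_mx polyC H *m ('X%:M - map_mx polyC A) *m map_mx polyC H.
    rewrite mulmxBr mulmxBl BE !map_mxM; congr (_ - _).
    by rewrite mul_mx_scalar -scalemxAl HH' scale_scalar_mx mulr1.
  by rewrite !det_mulmx mulrAC -det_mulmx HH' det1 mul1r.
have DT : (drsubmx B)^T = drsubmx B by rewrite trmx_drsub BT.
have cD : char_poly (drsubmx B) = \prod_(y <- s) ('X - y%:P).
  have := cB; rewrite cA big_cons EB {1}/char_poly char_block_diag_mx.
  rewrite det_ublock => E.
  have Ex : \det (char_poly_mx (x%:M : 'M[R]_1)) = 'X - x%:P.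
    by rewrite det_mx11 !mxE.
  apply: (@mulfI _ ('X - x%:P)); first by rewrite polyXsubC_eq0.
  by rewrite -E Ex block_mxKdr.
have [V [VV DV]] := IH _ s DT cD ss.
have [C CE] : {C : 'M[R]_(1 + d) | C = block_mx 1%:M 0 0 V} by eexists.
have CC : C^T *m C = 1%:M.
  rewrite CE tr_block_mx !trmx0 trmx1 mulmx_block.
  rewrite !(mulmx0, mul0mx, addr0, add0r, mul1mx) VV.
  by rewrite -scalar_mx_block.
have CD : C^T *m B *m C = block_mx x%:M 0 0 (diag_mx (\row_i s`_i)).
  rewrite CE EB tr_block_mx !trmx0 trmx1 !mulmx_block.
  by rewrite !(mulmx0, mul0mx, addr0, add0r, mul1mx, mulmx1) DV.
exists (H *m (C : 'M[R]_d.+1)); split.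
  by rewrite trmx_mul mulmxA -(mulmxA _ H^T) HT HH mulmx1 CC.
rewrite trmx_mul HT !mulmxA -(mulmxA _ H A) -(mulmxA _ (H *m A)) -BE.
transitivity (C^T *m B *m C); first by [].
rewrite CD.
apply/matrixP => i j; rewrite !mxE.
case: splitP => i' Ei; rewrite !mxE; case: splitP => j' Ej; rewrite !mxE.
- by rewrite !ord1 in Ei Ej *; rewrite -!val_eqE /= Ei Ej.
- by rewrite -val_eqE /= Ei Ej !ord1 mulr0n.
- by rewrite -val_eqE /= Ei Ej !ord1 mulr0n.
- by rewrite -!val_eqE /= Ei Ej.
Qed.

(** Separates the default of [xget] from a genuine splitting. With [[::]], [nth 0] returns 0: this
    respects every nonnegative upper bound and contradicts a positive lower bound, so both uses
    below survive. *)
Lemma ordered_eigenvaluesP {d} (A : 'M[R]_d) :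
  ordered_eigenvalues A = [::] \/
  sorted (fun x y => y <= x) (ordered_eigenvalues A) /\
  char_poly A = \prod_(x <- ordered_eigenvalues A) ('X - x%:P).
Proof.
rewrite /ordered_eigenvalues; set S := [set s | _].
by case: (xgetP [::] S) => [s -> Ss|]; [right|left].
Qed.

Lemma qform_diag {d} (A U : 'M[R]_d) s a : U^T *m A *m U = diag_mx s ->
  qform A (U *m a) = \sum_i s ord0 i * a i ord0 ^+ 2.
Proof.
move=> E; rewrite /qform trmx_mul !mulmxA -2!(mulmxA a^T) E -mulmxA dotE.
by apply: eq_bigr => i _; rewrite mul_diag_mx mxE expr2; ring.
Qed.

Lemma sqn_orthogonal {d} (U : 'M[R]_d) a : U^T *m U = 1%:M ->
  sqn (U *m a) = sqn a.
Proof. by move=> E; rewrite !sqnE trmx_mul mulmxA -(mulmxA a^T) E mulmx1. Qed.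

(* Courant-Fischer: the span of the first r+1 eigenvectors meets the kernel
   of B. *)
Lemma eigval_le {d r} (A B : 'M[R]_d) c : A^T = A -> (\rank B <= r < d)%N ->
  0 <= c -> (forall v, B *m v = 0 -> qform A v <= c * sqn v) ->
  eigval r.+1 A <= c.
Proof.
move=> AT /andP[rB rd] c0 H; rewrite /eigval /=.
have [->|[so cA]] := ordered_eigenvaluesP A; first by rewrite nth_nil.
set s := ordered_eigenvalues A in so cA *.
have [ss [U [UU UA]]] := sym_split_diagonalizable A s AT cA.
(* [U *m E] consists of the first r+1 eigenvectors. Since B has rank at most r, [B *m U *m E] kills
   a nonzero combination x of them. *)
set E : 'M[R]_(d, r.+1) := \matrix_(i, j) (i == j :> nat)%:R.
have : kermx (B *m U *m E)^T != 0.
  rewrite kermx_eq0 /row_free mxrank_tr neq_ltn; apply/orP; left.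
  rewrite -mulmxA ltnS (leq_trans (mxrankM_maxl _ _)) //.
move=> /rowV0Pn[x /sub_kermxP xK x0].
set a := E *m x^T.
have aE i : a i ord0 = if insub (i : nat) is Some j then x ord0 j else 0.
  rewrite mxE; case: insubP => [j _ ji|].
    rewrite (bigD1 j) //= mxE -ji eqxx mul1r mxE big1 ?addr0 // => k kj.
    rewrite mxE -ji; case: eqP => [/val_inj jk|]; last by rewrite mul0r.
    by rewrite jk eqxx in kj.
  rewrite -leqNgt => ri; rewrite big1 // => k _; rewrite mxE.
  by rewrite gtn_eqF ?mul0r // (leq_trans (ltn_ord k)).
have Ba : B *m (U *m a) = 0.
  apply: trmx_inj; rewrite trmx0 -xK /a -[in RHS](trmxK x) -trmx_mul.
  by rewrite !mulmxA.
clearbody a; have a0 : a != 0.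
  apply: contraNneq x0 => a0; apply/eqP/rowP => j; rewrite mxE.
  have jd : (j < d)%N by rewrite (leq_trans (ltn_ord j)).
  have := aE (Ordinal jd); rewrite a0 mxE; case: insubP => /= [k _ kj|].
    by move=> ->; congr (x _ _); exact: val_inj.
  by rewrite ltn_ord.
have := H _ Ba; rewrite sqn_orthogonal // (qform_diag _ _ _ _ UA) => Hc.
rewrite -(ler_pM2r (x := sqn a)) ?sqn_gt0 //; apply: le_trans Hc.
(* Termwise: a is supported on the first r+1 coordinates, where the decreasing eigenvalues are at
   least the (r+1)-st. *)
rewrite /sqn mulr_sumr; apply: ler_sum => i _; rewrite mxE.
rewrite aE; case: insubP => [j jr ji|]; last by rewrite expr0n !mulr0.
rewrite ler_wpM2r ?sqr_ge0 //.
have tr : transitive (fun x y : R => y <= x).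
  by move=> y z t yz ty; exact: le_trans ty yz.
apply: (sorted_leq_nth tr (fun x => lexx x) 0 so) => //=;
  by rewrite ?inE ?ss // -ltnS.
Qed.

(** In an eigenbasis the claim reads [lam * s_i <= s_i ^ 2] for each eigenvalue: the first r are at
    least lam by the gap, the others at most 0 by the rank. *)
Lemma eigval_gap {d r} (A : 'M[R]_d) lam v : psd A -> (\rank A <= r < d)%N ->
  0 < lam -> ((0 < r)%N -> lam <= eigval r A) ->
  lam * qform A v <= sqn (A *m v).
Proof.
move=> [AT Apos] rA lam0 Hgap.
have [r0|r0] := posnP r.
  move: rA; rewrite r0 leqn0 mxrank_eq0 => /andP[/eqP -> _].
  by rewrite qformE !mul0mx mulmx0 mxE mulr0 sqn_ge0.
have {Hgap} := Hgap r0; rewrite /eigval => Hgap.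
(* Courant-Fischer with A in both roles and bound 0, as the form of A vanishes on its own kernel. *)
have Hr : eigval r.+1 A <= 0.
  apply: (eigval_le A A) => // u Au; rewrite qformE Au mulmx0 mxE.
  by rewrite mul0r.
move: Hr; rewrite /eigval /= => Hr.
have [E|[so cA]] := ordered_eigenvaluesP A.
  by move: Hgap; rewrite E nth_nil leNgt lam0.
set s := ordered_eigenvalues A in so cA Hgap Hr *.
have [ss [U [UU UA]]] := sym_split_diagonalizable A s AT cA.
have UU' : U *m U^T = 1%:M by exact: mulmx1C.
set a := U^T *m v.
have -> : v = U *m a by rewrite mulmxA UU' mul1mx.
clearbody a; rewrite (qform_diag _ _ _ _ UA).
rewrite -(sqn_orthogonal U^T) ?trmxK // !mulmxA UA mulr_sumr.
apply: ler_sum => i _; rewrite mul_diag_mx !mxE exprMn mulrA.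
apply: ler_wpM2r; first exact: sqr_ge0.
have tr : transitive (fun x y : R => y <= x).
  by move=> y z t yz ty; exact: le_trans ty yz.
have mono j k : (k < d)%N -> (j <= k)%N -> s`_k <= s`_j.
  move=> kd jk; apply: (sorted_leq_nth tr (fun x => lexx x) 0 so) => //=;
  by rewrite inE ss // (leq_ltn_trans jk).
have [ir|ir] := ltnP i r.
  rewrite expr2 ler_wpM2r //.
    apply: le_trans (ltW lam0) (le_trans Hgap _).
    by apply: mono; [case/andP: rA => _; apply: ltn_trans; rewrite prednK|rewrite -ltnS prednK].
  apply: le_trans Hgap _.
  by apply: mono; [case/andP: rA => _; apply: ltn_trans; rewrite prednK|rewrite -ltnS prednK].
apply: le_trans (sqr_ge0 _).
by rewrite pmulr_rle0 // (le_trans (mono _ _ _ ir)).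
Qed.

End SquaredNorm.

(** * First and second moments of centred normal laws *)

Section NormalMoments.
Context {R : realType}.
Local Notation mu := (@lebesgue_measure R).

(** The Radon-Nikodym derivative agrees almost everywhere with the Gaussian density, both having the
    same integral over every measurable set. *)
Lemma ge0_integral_normal_prob (s : R) (g : R -> R) :
  measurable_fun setT g -> (forall x, 0 <= g x) ->
  (\int[normal_prob 0 s]_x (g x)%:E = \int[mu]_x (g x * normal_pdf 0 s x)%:E)%E.
Proof.
move=> mg g0.
have dom := normal_prob_dominates 0 s.
have mg' : measurable_fun setT (fun x : R => (g x)%:E) by exact/measurable_EFinP.
have mp : measurable_fun setT (fun x : R => (normal_pdf 0 s x)%:E).
  by apply/measurable_EFinP; exact: measurable_normal_pdf.
rewrite -(Radon_Nikodym_SigmaFinite.change_of_variables dom) //=; last first.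
apply: ae_eq_integral => //.
- apply: emeasurable_funM => //; apply: (measurable_int mu).
  exact: Radon_Nikodym_SigmaFinite.f_integrable.
- by apply/measurable_EFinP/measurable_funM => //; exact: measurable_normal_pdf.
- under [X in ae_eq _ _ _ X]eq_fun do rewrite EFinM.
  apply: ae_eqe_mul2l; apply: integral_ae_eq => //.
    exact: Radon_Nikodym_SigmaFinite.f_integrable.
  move=> E _ mE; rewrite -Radon_Nikodym_SigmaFinite.f_integral //.
Qed.

(** Kept as an extended real; once shown finite, its [fine] part is absorbed into the constant of
    the theorem. *)
Definition normal_variance : \bar R := (\int[mu]_x (x ^+ 2 * normal_pdf 0 1 x)%:E)%E.

Lemma normal_variance_ge0 : (0 <= normal_variance)%E.
Proof.
by apply: integral_ge0 => x _; rewrite lee_fin mulr_ge0 ?sqr_ge0 ?normal_pdf_ge0.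
Qed.

Lemma measurable_sqr_normal_pdf (s : R) :
  measurable_fun setT (fun x : R => x ^+ 2 * normal_pdf 0 s x).
Proof. by apply: measurable_funM; [exact: measurable_funX|exact: measurable_normal_pdf]. Qed.

(* [x^2 exp(- x^2 / 2) <= 8 exp(- x^2 / 8)], a multiple of another normal
   density. *)
Lemma normal_variance_fin_num : normal_variance \is a fin_num.
Proof.
rewrite ge0_fin_numE ?normal_variance_ge0 //.
set c := 8 * normal_peak 1 / normal_peak (2 : R).
have p2 : 0 < normal_peak (2 : R) by rewrite normal_peak_gt0.
apply: (@le_lt_trans _ _ (\int[mu]_x (c%:E * (normal_pdf 0 2 x)%:E))%E).
  apply: ge0_le_integral => //.
  - by move=> x _; rewrite lee_fin mulr_ge0 ?sqr_ge0 ?normal_pdf_ge0.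
  - by apply/measurable_EFinP; exact: measurable_sqr_normal_pdf.
  - apply/measurable_funeM/measurable_EFinP; exact: measurable_normal_pdf.
  move=> x _; rewrite -EFinM lee_fin !normal_pdfE //= /normal_fun /c.
  rewrite !subr0 [leRHS]mulrA (divfK (lt0r_neq0 p2)).
  rewrite (mulrCA (x ^+ 2)) -[leRHS]mulrA (mulrCA 8) ler_pM2l ?normal_peak_gt0 //.
  (* Multiplied by [exp(- x^2 / 2)] this leaves [exp(- 3 x^2 / 8)], which is at most
     [exp(- x^2 / 8)], the profile of the normal density with standard deviation 2. The ratio of the
     two peaks is in [c]. *)
  have H : x ^+ 2 / 8 <= expR (x ^+ 2 / 8).
    by apply: le_trans (expR_ge1Dx _); rewrite lerDr.
  rewrite -ler_pdivrMl // mulrA (mulrC 8^-1).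
  apply: le_trans (ler_wpM2r (expR_ge0 _) H) _.
  rewrite -expRD ler_expR expr1n.
  have -> : (2 : R) ^+ 2 *+ 2 = 8 by rewrite expr2 -natrM -mulr_natr -natrM.
  by have := sqr_ge0 x; move: (x ^+ 2) => y y0; lra.
rewrite ge0_integralZl //=; last 2 first.
- by move=> x _; rewrite lee_fin normal_pdf_ge0.
- by rewrite lee_fin divr_ge0 ?mulr_ge0 ?ltW ?normal_peak_gt0 ?oner_neq0.
- by rewrite integral_normal_pdf mule1 ltry.
by apply/measurable_EFinP; exact: measurable_normal_pdf.
Qed.

(** Substitution of s x for x: the Jacobian s turns the density with standard deviation s into the
    standard one. *)
Lemma integral_sqr_normal_prob (s : R) : 0 < s ->
  (\int[normal_prob 0 s]_x (x ^+ 2)%:E = (s ^+ 2)%:E * normal_variance)%E.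
Proof.
move=> s0; rewrite ge0_integral_normal_prob; last 2 first.
- exact: measurable_funX.
- by move=> x; exact: sqr_ge0.
have dF (x : R) : is_derive x 1 ( *%R s) s.
  by apply: is_derive_eq; rewrite ?scaler0 ?addr0 /GRing.scale /= mulr1.
have F' : (( *%R s)^`())%classic = cst s.
  by apply/funext => x; rewrite derive1E derive_val.
rewrite (@increasing_ge0_integration_by_substitutionT _ ( *%R s)) //.
- rewrite F' /normal_variance -ge0_integralZl //=.
  + apply: eq_integral => x _; congr EFin.
    rewrite !normal_pdfE ?gt_eqF ?oner_neq0 //= /normal_peak /normal_fun.
    rewrite -[LHS]/((s * x) ^+ 2 * ((Num.sqrt (s ^+ 2 * pi *+ 2))^-1 *
      expR (- (s * x - 0) ^+ 2 / (s ^+ 2 *+ 2))) * s).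
    rewrite !subr0; set p := Num.sqrt (1 ^+ 2 * pi *+ 2).
    have p0 : p != 0 by rewrite gt_eqF // sqrtr_gt0 expr1n mul1r mulrn_wgt0 // pi_gt0.
    have -> : Num.sqrt (s ^+ 2 * pi *+ 2) = s * p.
      rewrite -[s in RHS]gtr0_norm // -sqrtr_sqr -sqrtrM ?sqr_ge0 //.
      by rewrite /p expr1n mul1r; move: pi => q; rewrite mulrnAr.
    have -> : - (s * x) ^+ 2 / (s ^+ 2 *+ 2) = - x ^+ 2 / (1 ^+ 2 *+ 2).
      rewrite exprMn expr1n -mulrN -(mulr_natr (s ^+ 2)) invfM mulrACA.
      by rewrite mulfV ?mul1r // expf_neq0 // gt_eqF.
    move: (expR _) p0; clearbody p => e p0; field; rewrite p0 gt_eqF //.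
  + by apply/measurable_EFinP; exact: measurable_sqr_normal_pdf.
  + by move=> x _; rewrite lee_fin mulr_ge0 ?sqr_ge0 ?normal_pdf_ge0.
  + by rewrite lee_fin sqr_ge0.
- by move=> x y xy; rewrite ltr_pM2l.
- by rewrite F'; exact: cst_continuous.
- by rewrite F'; exact: is_cvg_cst.
- by rewrite F'; exact: is_cvg_cst.
- exact: gt0_cvgMrNy.
- exact: gt0_cvgMry.
- move=> x; apply: cvgM; first exact: exprn_continuous.
  by apply: continuous_normal_pdf; rewrite gt_eqF.
- by move=> x; rewrite mulr_ge0 ?sqr_ge0 ?normal_pdf_ge0.
Qed.

(** The density is even, so reflection exchanges the positive and the negative part, whose integrals
    have the mean as their difference. *)
Lemma integral_pos_normal_prob (s : R) : s != 0 ->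
  (\int[normal_prob 0 s]_x (Num.max x 0)%:E =
   \int[normal_prob 0 s]_x (Num.max (- x) 0)%:E)%E.
Proof.
move=> s0; rewrite !ge0_integral_normal_prob; last 4 first.
- by apply: measurable_maxr => //; exact: measurable_funN.
- by move=> x; rewrite le_max lexx orbT.
- by apply: measurable_maxr.
- by move=> x; rewrite le_max lexx orbT.
set G := fun x : R => Num.max (- x) 0 * normal_pdf 0 s x.
have G0 x : 0 <= G x by rewrite mulr_ge0 ?normal_pdf_ge0 // le_max lexx orbT.
have cG : continuous G.
  move=> x; apply: cvgM; last exact: continuous_normal_pdf.
  by apply: continuous_max; [exact: opp_continuous|exact: cst_continuous].
have GN x : Num.max x 0 * normal_pdf 0 s x = G (- x).
  by rewrite /G opprK !normal_pdfE //= /normal_fun !subr0 sqrrN.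
transitivity (\int[mu]_(x in `[0%R, +oo[) ((G \o -%R) x)%:E)%E.
  rewrite [RHS]integral_mkcond; apply: eq_integral => x _.
  rewrite patchE /= -GN; case: ifPn => //.
  rewrite notin_setE /= in_itv /= andbT => /negP; rewrite -ltNge => x0.
  by rewrite (max_idPr (ltW x0)) mul0r.
rewrite -ge0_integration_by_substitutionNy //; last first.
  exact: continuous_subspaceT.
rewrite oppr0 [LHS]integral_mkcond; apply: eq_integral => x _.
rewrite patchE /=; case: ifPn => //.
rewrite notin_setE /= in_itv /= => /negP; rewrite -ltNge => x0.
by rewrite /G (max_idPr _) ?mul0r // oppr_le0 ltW.
Qed.

End NormalMoments.

(** * Image laws and independence *)

Section Independence.
Context {R : realType} {disp : measure_display} {Omega : measurableType disp}.
Variable P : probability Omega R.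
Implicit Types X Y : Omega -> R.

Lemma integral_same_law X (nu : probability (measurableTypeR R) R) (g : R -> R) :
  measurable_fun setT X ->
  (forall B, measurable B -> P (X @^-1` B) = nu B) ->
  measurable_fun setT g -> (forall x, 0 <= g x) ->
  (\int[P]_w (g (X w))%:E = \int[nu]_x (g x)%:E)%E.
Proof.
move=> mX PX mg g0.
pose XR : Omega -> measurableTypeR R := X.
have mXR : measurable_fun setT XR by exact: mX.
pose X' : {mfun Omega >-> measurableTypeR R} :=
  HB.pack XR (isMeasurableFun.Build _ _ _ _ XR mXR).
transitivity (\int[distribution P X']_x (g x)%:E)%E.
  rewrite /distribution ge0_integral_pushforward //; first exact/measurable_EFinP.
  by move=> x _; rewrite lee_fin.
apply: (@eq_measure_integral _ (measurableTypeR R) R setT nu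
  (distribution P X')) => B mB _.
exact: PX.
Qed.

(** Independence identifies the joint law with the product law, as they agree on rectangles. Fubini
    then integrates y first, and the inner integral is x times the mean of Y, hence 0. *)
Lemma uncorrelated_of_independent X Y :
  measurable_fun setT X -> measurable_fun setT Y ->
  (forall A B, measurable A -> measurable B ->
     P (X @^-1` A `&` Y @^-1` B) = (P (X @^-1` A) * P (Y @^-1` B))%E) ->
  P.-integrable setT (fun w => (X w * Y w)%:E) ->
  P.-integrable setT (fun w => (Y w)%:E) ->
  (\int[P]_w (Y w)%:E = 0)%E ->
  (\int[P]_w (X w * Y w)%:E = 0)%E.
Proof.
move=> mX mY XY iXY iY Y0.
pose T := measurableTypeR R.
pose XR : Omega -> T := X; pose YR : Omega -> T := Y.
have mXR : measurable_fun setT XR by exact: mX.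
have mYR : measurable_fun setT YR by exact: mY.
pose X' : {mfun Omega >-> T} := HB.pack XR (isMeasurableFun.Build _ _ _ _ XR mXR).
pose Y' : {mfun Omega >-> T} := HB.pack YR (isMeasurableFun.Build _ _ _ _ YR mYR).
pose m1 := distribution P X'; pose m2 := distribution P Y'.
pose Z w : T * T := (X w, Y w).
have mZ : measurable_fun setT Z by exact: (measurable_fun_pair mXR mYR).
pose Z' : {mfun Omega >-> (T * T)%type} :=
  HB.pack Z (isMeasurableFun.Build _ _ _ _ Z mZ).
pose f (z : T * T) : \bar R := ((z.1 : R) * (z.2 : R))%:E.
have mf : measurable_fun setT f.
  apply/measurable_EFinP; apply: measurable_funM.
    exact: (@measurable_fst _ _ T T).
  exact: (@measurable_snd _ _ T T).
have E (g : T * T -> \bar R) :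
    (\int[m1 \x m2]_z g z = \int[distribution P Z']_z g z)%E.
  apply: (@eq_measure_integral _ _ R setT (distribution P Z')) => A mA _.
  by apply: product_measure_unique => // B C mB mC.
have <- : (\int[distribution P Z']_z f z = \int[P]_w (X w * Y w)%:E)%E.
  by rewrite /distribution (integral_pushforward mZ mf).
rewrite -E.
have intf : (m1 \x m2)%E.-integrable setT f.
  apply/integrableP; split=> //; rewrite E /distribution.
  rewrite ge0_integral_pushforward //; last exact: measurableT_comp.
  by have /integrableP[] := iXY.
rewrite -integral12_prod_meas1 // integral0_eq // => x _.
rewrite /fubini_F /f /=.
under eq_integral do rewrite EFinM.
have mid : measurable_fun setT (fun y : T => (y : R)%:E) by exact/measurable_EFinP.
rewrite integralZl //.
  have -> : (\int[m2]_y (y : R)%:E = \int[P]_w (Y w)%:E)%E.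
    by rewrite /m2 /distribution (integral_pushforward mYR mid).
  by rewrite Y0 mule0.
exact: (integrable_pushforward mYR mid).
Qed.

End Independence.

(** * Square-integrable variables and the moments given by a normal law *)

Section SquareIntegrable.
Context {R : realType} {disp : measure_display} {Omega : measurableType disp}.
Variable P : probability Omega R.
Implicit Types X Y : Omega -> R.

(** The product is dominated by [X ^ 2 + Y ^ 2]. *)
Lemma integrable_mul_of_sqr X Y :
  measurable_fun setT X -> measurable_fun setT Y ->
  (\int[P]_w (X w ^+ 2)%:E < +oo)%E -> (\int[P]_w (Y w ^+ 2)%:E < +oo)%E ->
  P.-integrable setT (fun w => (X w * Y w)%:E).
Proof.
move=> mX mY X2 Y2; apply/integrableP; split.
  exact/measurable_EFinP/measurable_funM.
apply: (@le_lt_trans _ _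
  (\int[P]_w ((X w ^+ 2)%:E + (Y w ^+ 2)%:E))%E); last first.
  rewrite ge0_integralD //=; first exact: lte_add_pinfty.
  - by move=> w _; rewrite lee_fin sqr_ge0.
  - by apply/measurable_EFinP; exact: measurable_funX.
  - by move=> w _; rewrite lee_fin sqr_ge0.
  - by apply/measurable_EFinP; exact: measurable_funX.
apply: ge0_le_integral => //=.
- apply/measurable_EFinP/measurableT_comp => //; exact: measurable_funM.
- by apply: emeasurable_funD; apply/measurable_EFinP; exact: measurable_funX.
- move=> w _; rewrite lee_fin ler_norml; apply/andP; split.
    by have := sqr_ge0 (X w + Y w); have := sqr_ge0 (X w);
       have := sqr_ge0 (Y w); rewrite sqrrD; lra.
  by have := sqr_ge0 (X w - Y w); have := sqr_ge0 (X w);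
     have := sqr_ge0 (Y w); rewrite sqrrB; lra.
Qed.

Lemma integrable_of_sqr X : measurable_fun setT X ->
  (\int[P]_w (X w ^+ 2)%:E < +oo)%E -> P.-integrable setT (fun w => (X w)%:E).
Proof.
move=> mX X2.
have -> : (fun w => (X w)%:E) = (fun w => (X w * cst 1 w)%:E).
  by apply/funext => w; rewrite mulr1.
apply: integrable_mul_of_sqr => //.
rewrite (eq_integral (cst 1%E)); last by move=> w _; rewrite expr1n.
by rewrite integral_cst //= mul1e probability_setT ltry.
Qed.

Lemma normal_law_moments X (v : R) : measurable_fun setT X -> 0 < v ->
  (forall B, measurable B -> P (X @^-1` B) = normal_prob 0 (Num.sqrt v) B) ->
  (\int[P]_w (X w ^+ 2)%:E = v%:E * normal_variance)%E /\
  (\int[P]_w (X w)%:E = 0)%E.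
Proof.
move=> mX v0 PX; have s0 : 0 < Num.sqrt v by rewrite sqrtr_gt0.
have E2 : (\int[P]_w (X w ^+ 2)%:E = v%:E * normal_variance)%E.
  have := @integral_same_law _ _ _ P X (normal_prob 0 (Num.sqrt v)) (fun x => x ^+ 2) mX PX.
  move=> ->; [|exact: measurable_funX|by move=> x; exact: sqr_ge0].
  by rewrite integral_sqr_normal_prob // sqr_sqrtr // ltW.
split=> //.
have iX : P.-integrable setT (fun w => (X w)%:E).
  apply: integrable_of_sqr => //; rewrite E2.
  by rewrite lte_mul_pinfty ?lee_fin ?(ltW v0) // -ge0_fin_numE ?normal_variance_fin_num // normal_variance_ge0.
have Ep : (\int[P]_w (Num.max (X w) 0)%:E = \int[P]_w (Num.max (- X w) 0)%:E)%E.
  have Hp := @integral_same_law _ _ _ P X (normal_prob 0 (Num.sqrt v)) (fun x => Num.max x 0) mX PX.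
  have Hn := @integral_same_law _ _ _ P X (normal_prob 0 (Num.sqrt v)) (fun x => Num.max (- x) 0) mX PX.
  rewrite Hp; [|by apply: measurable_maxr|by move=> x; rewrite le_max lexx orbT].
  rewrite Hn; [|by apply: measurable_maxr => //; exact: measurable_funN|by move=> x; rewrite le_max lexx orbT].
  by rewrite integral_pos_normal_prob // gt_eqF.
have Ef : (fun w => (X w)%:E)^\+%E = (fun w => (Num.max (X w) 0)%:E).
  by apply/funext => w; rewrite funeposE EFin_max.
have En : (fun w => (X w)%:E)^\-%E = (fun w => (Num.max (- X w) 0)%:E).
  by apply/funext => w; rewrite funenegE EFin_max.
rewrite integralE Ef En Ep subee //.
by have := integrable_neg_fin_num measurableT iX; rewrite En.
Qed.

End SquareIntegrable.

(** * Coordinates of random vectors *)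

Section RandomVectors.
Context {R : realType} {disp : measure_display} {Omega : measurableType disp}.

Lemma sigma_vec_preimage {d} (V : Omega -> 'cV[R]_d) i (B : set R) :
  measurable B -> sigma_vec V [set w | B (V w i ord0)].
Proof. by move=> mB; apply: sub_sigma_algebra; exists i, B. Qed.

Lemma measurable_wrt_component {d} (V : Omega -> 'cV[R]_d) i :
  measurable_wrt measurable V -> measurable_fun setT (fun w => V w i ord0).
Proof.
move=> mV _ B mB; rewrite setTI; apply: mV.
exact: (sigma_vec_preimage V i B mB).
Qed.

(** A marginal is read off from the boxes whose other sides are the whole line. *)
Lemma isotropic_normal_component (P : probability Omega R) {d} (v : R)
    (V : Omega -> 'cV[R]_d) i (B : set R) :
  isotropic_normal P v V -> measurable B ->
  P [set w | B (V w i ord0)] = normal_prob 0 (Num.sqrt v) B.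
Proof.
move=> nV mB.
have := nV (fun j => if j == i then B else setT).
have -> : [set w | forall j, (if j == i then B else setT) (V w j ord0)] =
          [set w | B (V w i ord0)].
  apply/seteqP; split=> w /=; first by move=> /(_ i); rewrite eqxx.
  by move=> Bw j; case: eqP => // ->.
move=> ->; last by move=> j; case: ifP.
rewrite (bigD1 i) //= eqxx big1 ?mule1 // => j /negbTE ->.
exact: probability_setT.
Qed.

Lemma isotropic_normal_component2 (P : probability Omega R) {d} (v : R)
    (V : Omega -> 'cV[R]_d) i j (A B : set R) :
  isotropic_normal P v V -> i != j -> measurable A -> measurable B ->
  P ([set w | A (V w i ord0)] `&` [set w | B (V w j ord0)]) =
  (P [set w | A (V w i ord0)] * P [set w | B (V w j ord0)])%E.
Proof.
move=> nV ij mA mB.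
rewrite !(isotropic_normal_component P v) //.
have := nV (fun k => if k == i then A else if k == j then B else setT).
have -> : [set w | forall k, (if k == i then A else if k == j then B else setT) (V w k ord0)] =
          [set w | A (V w i ord0)] `&` [set w | B (V w j ord0)].
  apply/seteqP; split=> w /=.
    move=> H; split; first by have := H i; rewrite eqxx.
    by have := H j; rewrite eqxx eq_sym (negbTE ij).
  by move=> [Aw Bw] k; case: eqP => [->//|_]; case: eqP => // ->.
move=> ->; last by move=> k; do 2! case: ifP => //.
rewrite (bigD1 i) //= eqxx (bigD1 j) /=; last by rewrite eq_sym.
rewrite eqxx eq_sym (negbTE ij) big1 ?mule1 // => k /andP[/negbTE -> /negbTE ->].
exact: probability_setT.
Qed.

End RandomVectors.

(** * Covariances of Brownian motion *)

Section BrownianMotion.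
Context {R : realType} {disp : measure_display} {Omega : measurableType disp}.
Context {P : probability Omega R} {F : R -> set (set Omega)} {m : nat}.
Context {W : R -> Omega -> 'cV[R]_m}.
Hypothesis filF : filtration F.
Hypothesis bmW : brownian_motion P F W.
Local Notation mu := (@lebesgue_measure R).

Lemma bm_measurable t : 0 <= t -> measurable_wrt measurable (W t).
Proof.
move=> t0; have [_ Fm _] := filF; have [Wm _ _ _ _] := bmW.
exact: subset_trans (Wm _ t0) (Fm _ t0).
Qed.

Lemma bm_measurable_fun t i : 0 <= t -> measurable_fun setT (fun w => W t w i ord0).
Proof. by move=> /bm_measurable; exact: measurable_wrt_component. Qed.

Let D s t i w := W t w i ord0 - W s w i ord0.

Lemma bm_increment_measurable s t i : 0 <= s -> 0 <= t -> measurable_fun setT (D s t i).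
Proof. by move=> s0 t0; apply: measurable_funB; exact: bm_measurable_fun. Qed.

Lemma bm_increment_moments s t i : 0 <= s -> s < t ->
  (\int[P]_w (D s t i w ^+ 2)%:E = (t - s)%:E * normal_variance)%E /\
  (\int[P]_w (D s t i w)%:E = 0)%E.
Proof.
move=> s0 st; have t0 := le_trans s0 (ltW st).
have [_ _ _ Wn _] := bmW.
apply: normal_law_moments; rewrite ?subr_gt0 //.
  exact: bm_increment_measurable.
move=> B mB; rewrite -(isotropic_normal_component _ _ _ i B (Wn _ _ s0 st)) //.
by congr (P _); apply/seteqP; split=> w; rewrite /= !mxE.
Qed.

Lemma bm_increment_sqr_lty s t i : 0 <= s -> s < t ->
  (\int[P]_w (D s t i w ^+ 2)%:E < +oo)%E.
Proof.
move=> s0 st; have [-> _] := bm_increment_moments s t i s0 st.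
rewrite lte_mul_pinfty ?lee_fin ?subr_ge0 ?(ltW st) //.
by rewrite -ge0_fin_numE ?normal_variance_fin_num // normal_variance_ge0.
Qed.

Lemma bm_increment_uncorrelated s t i j : 0 <= s -> s < t -> i != j ->
  (\int[P]_w (D s t i w * D s t j w)%:E = 0)%E.
Proof.
move=> s0 st ij; have t0 := le_trans s0 (ltW st).
have mD k : measurable_fun setT (D s t k) by exact: bm_increment_measurable.
have fD k := bm_increment_sqr_lty s t k s0 st.
have [_ _ _ Wn _] := bmW.
have [_ ED] := bm_increment_moments s t j s0 st.
apply: uncorrelated_of_independent => //; last 2 first.
- exact: integrable_mul_of_sqr.
- exact: integrable_of_sqr.
move=> A B mA mB.
have E k (C : set R) : D s t k @^-1` C = [set w | C ((W t w - W s w) k ord0)].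
  by apply/seteqP; split=> w; rewrite /= !mxE.
rewrite !E; exact: isotropic_normal_component2 (Wn _ _ s0 st) ij mA mB.
Qed.

(** Only increments have a prescribed law; this makes W(s) itself one of them, almost surely. *)
Lemma bm_from0 s i : {ae P, forall w, W s w i ord0 = D 0 s i w}.
Proof.
have [_ W0 _ _ _] := bmW.
by apply: filterS W0 => w W0; rewrite /D W0 mxE subr0.
Qed.

Lemma bm_sqr_lty s i : 0 <= s -> (\int[P]_w (W s w i ord0 ^+ 2)%:E < +oo)%E.
Proof.
move=> s0; rewrite (@ae_eq_integral _ _ _ P setT (fun w => (D 0 s i w ^+ 2)%:E)) //.
- move: s0; rewrite le_eqVlt => /predU1P[<-|s0].
    by rewrite integral0_eq ?ltry // => w _; rewrite /D subrr expr0n.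
  exact: bm_increment_sqr_lty.
- by apply/measurable_EFinP; apply: measurable_funX; exact: bm_measurable_fun.
- by apply/measurable_EFinP; apply: measurable_funX; exact: bm_increment_measurable.
- by apply: filterS (bm_from0 s i) => w -> _.
Qed.

Lemma bm_cov_same s i j : 0 <= s ->
  (\int[P]_w (W s w i ord0 * W s w j ord0)%:E =
   (fine normal_variance * (s * (i == j)%:R))%:E)%E.
Proof.
move=> s0; rewrite (@ae_eq_integral _ _ _ P setT (fun w => (D 0 s i w * D 0 s j w)%:E)) //; last 3 first.
- by apply/measurable_EFinP; apply: measurable_funM; exact: bm_measurable_fun.
- by apply/measurable_EFinP; apply: measurable_funM; exact: bm_increment_measurable.
- by apply: filterS2 (bm_from0 s i) (bm_from0 s j) => w -> -> _.
move: s0; rewrite le_eqVlt => /predU1P[<-|s0].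
  by rewrite mul0r mulr0 integral0_eq // => w _; rewrite /D subrr mul0r.
case: eqVneq => [<-|ij]; last by rewrite bm_increment_uncorrelated // !mulr0.
have [E _] := bm_increment_moments 0 s i (lexx _) s0.
under eq_integral do rewrite -expr2.
by rewrite E subr0 mulr1 mulrC EFinM fineK // normal_variance_fin_num.
Qed.

Lemma bm_cov_incr s t i j : 0 <= s -> s < t ->
  (\int[P]_w (W s w i ord0 * D s t j w)%:E = 0)%E.
Proof.
move=> s0 st; have t0 := le_trans s0 (ltW st).
have [Wm _ _ _ Wi] := bmW.
have [_ ED] := bm_increment_moments s t j s0 st.
have mD : measurable_fun setT (D s t j) by exact: bm_increment_measurable.
have fD := bm_increment_sqr_lty s t j s0 st.
apply: uncorrelated_of_independent => //.
- exact: bm_measurable_fun.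
- move=> A B mA mB; apply: (Wi _ _ s0 st).
    by apply: (Wm _ s0); exact: (sigma_vec_preimage (W s) i A mA).
  have -> : D s t j @^-1` B = [set w | B ((W t w - W s w) j ord0)].
    by apply/seteqP; split=> w; rewrite /= !mxE.
  exact: sigma_vec_preimage.
- apply: integrable_mul_of_sqr => //; first exact: bm_measurable_fun.
  exact: bm_sqr_lty.
- exact: integrable_of_sqr.
Qed.

Lemma bm_integrable_mul s t i j : 0 <= s -> 0 <= t ->
  P.-integrable setT (fun w => (W s w i ord0 * W t w j ord0)%:E).
Proof.
by move=> s0 t0; apply: integrable_mul_of_sqr;
  first [exact: bm_measurable_fun|exact: bm_sqr_lty].
Qed.

(** For s < t, W(t) is W(s) plus an increment that is independent of F(s) and centred. The factor
    [min s t] is what the isometry will recognise as an L2 product of indicators. *)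
Lemma bm_cov s t i j : 0 <= s -> 0 <= t ->
  (\int[P]_w (W s w i ord0 * W t w j ord0)%:E =
   (fine normal_variance * (Num.min s t * (i == j)%:R))%:E)%E.
Proof.
wlog st : s t i j / s <= t => [H s0 t0|s0 t0].
  case/orP: (le_total s t) => st; first exact: H.
  under eq_integral do rewrite mulrC.
  by rewrite H // minC eq_sym.
rewrite (min_idPl st); move: st; rewrite le_eqVlt => /predU1P[<-|st].
  exact: bm_cov_same.
transitivity (\int[P]_w ((W s w i ord0 * W s w j ord0)%:E + (W s w i ord0 * D s t j w)%:E))%E.
  by apply: eq_integral => w _; rewrite -EFinD /D; congr EFin; ring.
rewrite integralD //=; first by rewrite bm_cov_same // bm_cov_incr // adde0.
- exact: bm_integrable_mul.
- apply: integrable_mul_of_sqr.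
  + exact: bm_measurable_fun.
  + exact: bm_increment_measurable.
  + exact: bm_sqr_lty.
  + exact: bm_increment_sqr_lty.
Qed.

End BrownianMotion.

(** * The isometry for step integrals *)

Section WienerIsometry.
Context {R : realType} {disp : measure_display} {Omega : measurableType disp}.
Context {P : probability Omega R} {F : R -> set (set Omega)} {m : nat}.
Context {W : R -> Omega -> 'cV[R]_m}.
Hypothesis filF : filtration F.
Hypothesis bmW : brownian_motion P F W.
Local Notation mu := (@lebesgue_measure R).

(** Written with the coefficient -1 to match the combination [a * p + p'] of [isometric_lin]. *)
Lemma indic_itv_diff (a b x : R) : 0 <= a -> a <= b ->
  \1_(`]a, b]) x = -1 * \1_(`]0, a]) x + \1_(`]0, b]) x :> R.
Proof.
move=> a0 ab; rewrite !indicE !mem_setE !in_itv /=.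
have [xa|ax] := leP x a.
  by rewrite (le_trans xa ab) !andbT; case: (0 < x); rewrite ?mulN1r ?addNr ?mulr0 ?addr0.
by rewrite (le_lt_trans a0 ax) mulr0 add0r.
Qed.

Definition dotr (u v : 'rV[R]_m) : R := \sum_i u ord0 i * v ord0 i.

Lemma dotrC u v : dotr u v = dotr v u.
Proof. by apply: eq_bigr => i _; rewrite mulrC. Qed.

Lemma dotrDl u v z : dotr (u + v) z = dotr u z + dotr v z.
Proof. by rewrite -big_split; apply: eq_bigr => i _; rewrite mxE mulrDl. Qed.

Lemma dotrZl a u z : dotr (a *: u) z = a * dotr u z.
Proof. by rewrite mulr_sumr; apply: eq_bigr => i _; rewrite mxE mulrA. Qed.

Lemma dotr0l z : dotr 0 z = 0.
Proof. by rewrite /dotr big1 // => i _; rewrite mxE mul0r. Qed.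

(* The isometry is a bilinear relation between pairs (random variable,
   integrand), so it suffices to check it on the pairs (W^i_t, 1_(0,t] e_i);
   no common refinement of partitions is needed. *)
Definition isometric (p q : (Omega -> R) * (R -> 'rV[R]_m)) : Prop :=
  [/\ P.-integrable setT (fun w => (p.1 w * q.1 w)%:E),
      mu.-integrable setT (fun s => (dotr (p.2 s) (q.2 s))%:E) &
      \int[P]_w (p.1 w * q.1 w) =
      fine normal_variance * \int[mu]_s dotr (p.2 s) (q.2 s)].

Lemma isometric_sym p q : isometric p q -> isometric q p.
Proof.
move=> [i1 i2 E]; split.
- by under eq_fun do rewrite mulrC.
- by under eq_fun do rewrite dotrC.
- under eq_Rintegral do rewrite mulrC.
  by rewrite E; congr (_ * _); apply: eq_Rintegral => s _; rewrite dotrC.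
Qed.

Lemma isometric_lin a p p' q : isometric p q -> isometric p' q ->
  isometric (fun w => a * p.1 w + p'.1 w, fun s => a *: p.2 s + p'.2 s) q.
Proof.
move=> [i1 i2 E] [i1' i2' E']; split => /=.
- have -> : (fun w => ((a * p.1 w + p'.1 w) * q.1 w)%:E) =
      (fun w => (a%:E * (p.1 w * q.1 w)%:E) + (p'.1 w * q.1 w)%:E)%E.
    by apply/funext => w; rewrite -EFinM -EFinD mulrDl mulrA.
  by apply: integrableD => //; exact: integrableZl.
- have -> : (fun s => (dotr (a *: p.2 s + p'.2 s) (q.2 s))%:E) =
      (fun s => (a%:E * (dotr (p.2 s) (q.2 s))%:E) + (dotr (p'.2 s) (q.2 s))%:E)%E.
    by apply/funext => w; rewrite -EFinM -EFinD dotrDl dotrZl.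
  by apply: integrableD => //; exact: integrableZl.
- under eq_Rintegral do rewrite mulrDl -mulrA.
  under [in RHS]eq_Rintegral do rewrite dotrDl dotrZl.
  have iZ : P.-integrable setT (EFin \o (fun w => a * (p.1 w * q.1 w))).
    by rewrite /comp; under eq_fun do rewrite EFinM; exact: integrableZl.
  have iZ' : mu.-integrable setT (EFin \o (fun s => a * dotr (p.2 s) (q.2 s))).
    by rewrite /comp; under eq_fun do rewrite EFinM; exact: integrableZl.
  by rewrite !RintegralD // !RintegralZl // E E'; ring.
Qed.

Lemma isometric0 q : isometric (cst 0, cst 0) q.
Proof.
split => /=.
- by under eq_fun do rewrite mul0r; exact: integrable0.
- by under eq_fun do rewrite dotr0l; exact: integrable0.
- under eq_Rintegral do rewrite mul0r.
  under [in RHS]eq_Rintegral do rewrite dotr0l.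
  by rewrite /Rintegral !integral0 mulr0.
Qed.

Lemma isometric_sum (I : Type) (r : seq I) (a : I -> R) p q :
  (forall i, isometric (p i) q) ->
  isometric (fun w => \sum_(i <- r) a i * (p i).1 w,
             fun s => \sum_(i <- r) a i *: (p i).2 s) q.
Proof.
move=> H; elim: r => [|i r IH].
  have -> : (fun w : Omega => \sum_(i <- [::]) a i * (p i).1 w) = cst 0.
    by apply/funext => w; rewrite big_nil.
  have -> : (fun s : R => \sum_(i <- [::]) a i *: (p i).2 s) = cst 0.
    by apply/funext => w; rewrite big_nil.
  exact: isometric0.
under eq_fun do rewrite big_cons.
under [X in isometric (_, X)]eq_fun do rewrite big_cons.
exact: (isometric_lin (a i) (p i) _ q (H i) IH).
Qed.

Definition bm_coord t i : (Omega -> R) * (R -> 'rV[R]_m) :=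
  (fun w => W t w i ord0, fun s => \1_(`]0, t]) s *: delta_mx ord0 i).

(** The product of the two indicators is the indicator of []0, min s t]], whose length is the
    Brownian covariance. *)
Lemma isometric_bm_coord s t i j : 0 <= s -> 0 <= t ->
  isometric (bm_coord s i) (bm_coord t j).
Proof.
move=> s0 t0.
have D x : dotr ((bm_coord s i).2 x) ((bm_coord t j).2 x) =
    \1_(`]0, Num.min s t]) x * (i == j)%:R.
  rewrite /= dotrZl dotrC dotrZl.
  have -> : dotr (delta_mx ord0 j) (delta_mx ord0 i) = (i == j)%:R.
    rewrite /dotr (bigD1 j) //= !mxE !eqxx mul1r big1 ?addr0; first by rewrite eq_sym.
    by move=> k /negbTE kj; rewrite !mxE /= kj mul0r.
  rewrite mulrA; congr (_ * _); rewrite -[LHS]/((\1__ \* \1__) x) -indicI.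
  congr (\1_ _ x); apply/seteqP; split=> y /=; rewrite !in_itv /= le_min.
    by move=> [/andP[-> ->] /andP[_ ->]].
  by move=> /and3P[-> -> ->].
have mI : mu `]0, Num.min s t] = (Num.min s t)%:E.
  rewrite lebesgue_measure_itv /= lte_fin.
  case: ifP => [_|/negbT]; first by rewrite oppr0 adde0.
  rewrite -leNgt => H; congr EFin; apply/eqP; rewrite eq_le H.
  by rewrite le_min s0 t0.
have eI : (\int[mu]_x (\1_(`]0%R, Num.min s t]) x)%:E = (Num.min s t)%:E)%E.
  by rewrite integral_indic // setIT; exact: mI.
have iI : mu.-integrable setT (fun x => (\1_(`]0, Num.min s t]) x)%:E).
  apply/integrableP; split; first exact/measurable_EFinP/measurable_indic.
  under eq_integral do rewrite gee0_abs ?lee_fin //.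
  by rewrite eI ltry.
split.
- exact: (bm_integrable_mul filF bmW).
- have -> : (fun x => (dotr ((bm_coord s i).2 x) ((bm_coord t j).2 x))%:E) =
      (fun x => ((i == j)%:R%:E * (\1_(`]0%R, Num.min s t]) x)%:E)%E).
    by apply/funext => x; rewrite D mulrC EFinM.
  exact: integrableZl.
- have RI : \int[mu]_x \1_(`]0, Num.min s t]) x = Num.min s t.
    by rewrite /Rintegral eI.
  under [in RHS]eq_Rintegral do rewrite D mulrC.
  by rewrite RintegralZl // RI /Rintegral (bm_cov filF bmW) //= (mulrC (Num.min s t)).
Qed.

Definition bm_row t (u : 'rV[R]_m) : (Omega -> R) * (R -> 'rV[R]_m) :=
  (fun w => (u *m W t w) ord0 ord0, fun s => \1_(`]0, t]) s *: u).

Lemma isometric_bm_rowl t u q : (forall i, isometric (bm_coord t i) q) ->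
  isometric (bm_row t u) q.
Proof.
move=> H; have := isometric_sum _ (index_enum 'I_m) (u ord0) (bm_coord t) q H.
congr (isometric (_, _) q).
  by apply/funext => w; rewrite /= mxE.
apply/funext => s; rewrite /= [in RHS](row_sum_delta u) scaler_sumr.
by apply: eq_bigr => i _; rewrite !scalerA mulrC.
Qed.

Definition step_pair {d} (q : 'cV[R]_d) N (tau : nat -> R) (v : nat -> 'M[R]_(d, m)) :
    (Omega -> R) * (R -> 'rV[R]_m) :=
  (fun w => (q^T *m step_int W N tau v w) ord0 ord0,
   fun s => q^T *m step_fun N tau v s).

Definition step_times N (tau : nat -> R) c := forall k, (k < N)%N ->
  [/\ 0 <= tau k, tau k <= tau k.+1 & tau k.+1 <= c].

(** Each step is the difference of two pairs [bm_row], at [tau k.+1] and at [tau k], so linearity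
    reduces the claim to Brownian coordinates. *)
Lemma isometric_step_pairl d (q : 'cV[R]_d) N tau v c p :
  step_times N tau c ->
  (forall t i, 0 <= t -> isometric (bm_coord t i) p) ->
  isometric (step_pair q N tau v) p.
Proof.
move=> H Hp.
set g := fun k : 'I_N => (fun w => (-1) * (bm_row (tau k) (q^T *m v k)).1 w + (bm_row (tau k.+1) (q^T *m v k)).1 w,
   fun s => (-1) *: (bm_row (tau k) (q^T *m v k)).2 s + (bm_row (tau k.+1) (q^T *m v k)).2 s).
have Hg k : isometric (g k) p.
  have [t0 t1 _] := H k (ltn_ord k).
  apply: isometric_lin; apply: isometric_bm_rowl => i; apply: Hp => //.
  exact: le_trans t1.
have := isometric_sum _ (index_enum 'I_N) (fun=> 1) g p Hg.
congr (isometric (_, _) p); apply/funext => w.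
  rewrite /step_int mulmx_sumr summxE; apply: eq_bigr => k _.
  by rewrite mul1r /= mulmxA mulmxBr !mxE mulN1r addrC.
rewrite /step_fun mulmx_sumr; apply: eq_bigr => k _.
rewrite scale1r /= -scalemxAr scalerA -scalerDl; congr (_ *: _).
by have [t0 t1 _] := H k (ltn_ord k); rewrite [RHS]indic_itv_diff.
Qed.

End WienerIsometry.

(** * Coordinatewise measurability *)

Section MeasurableVectors.
Context {R : realType} {disp : measure_display} {Omega : measurableType disp}.

Definition measurable_vec {d} (V : Omega -> 'cV[R]_d) : Prop :=
  forall i, measurable_fun setT (fun w => V w i ord0).

Lemma measurable_vecB {d} (V V' : Omega -> 'cV[R]_d) :
  measurable_vec V -> measurable_vec V' -> measurable_vec (fun w => V w - V' w).
Proof.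
move=> mV mV' i; under eq_fun do rewrite !mxE.
exact: measurable_funB.
Qed.

Lemma measurable_vec_mulmx {p d} (A : 'M[R]_(p, d)) (V : Omega -> 'cV[R]_d) :
  measurable_vec V -> measurable_vec (fun w => A *m V w).
Proof.
move=> mV i; under eq_fun do rewrite mxE.
by apply: measurable_sum => j; apply: measurable_funM.
Qed.

Lemma measurable_vec_sum {d} (I : Type) (r : seq I) (V : I -> Omega -> 'cV[R]_d) :
  (forall i, measurable_vec (V i)) -> measurable_vec (fun w => \sum_(i <- r) V i w).
Proof.
move=> mV i; under eq_fun do rewrite summxE.
by apply: measurable_sum => j; exact: mV.
Qed.

Lemma measurable_sqn {d} (V : Omega -> 'cV[R]_d) :
  measurable_vec V -> measurable_fun setT (fun w => sqn (V w)).
Proof. by move=> mV; apply: measurable_sum => i; apply: measurable_funX. Qed.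

End MeasurableVectors.

(** * Second moments of increments of the stochastic integral *)

Section ItoIncrement.
Context {R : realType} {disp : measure_display} {Omega : measurableType disp}.
Context {P : probability Omega R} {F : R -> set (set Omega)} {d m : nat}.
Context {W : R -> Omega -> 'cV[R]_m} {sigma : R -> 'M[R]_(d, m)}.
Hypothesis filF : filtration F.
Hypothesis bmW : brownian_motion P F W.
Hypothesis volS : admissible_volatility sigma.
Local Notation mu := (@lebesgue_measure R).

Let err N tau v s :=
  \tr ((step_fun N tau v s - sigma s) *m (step_fun N tau v s - sigma s)^T).

Lemma near0_lt (u : nat -> \bar R) (e : R) : 0 < e ->
  (u @ \oo --> 0%E)%classic -> \forall l \near \oo, (u l < e%:E)%E.
Proof.
move=> e0 u0; apply: (u0 [set x | (x < e%:E)%E]); apply: open_ereal_lt'.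
by rewrite lte_fin.
Qed.

(** Both limits run along the same sequence, so one index serves the integrand and the integral at
    once. *)
Lemma ito_integral_approx t I e : 0 < e -> ito_integral P W t sigma I ->
  exists N tau v, [/\ step_times N tau t,
   (\int[mu]_(s in `[0%R, t]) (err N tau v s)%:E <= e%:E)%E &
   (\int[P]_w (sqn (I w - step_int W N tau v w))%:E <= e%:E)%E].
Proof.
move=> e0 [_ [N [tau [v [Ht H1 H2]]]]].
have [l [L1 L2]] : exists l,
   (\int[mu]_(s in `[0%R, t]) (err (N l) (tau l) (v l) s)%:E < e%:E)%E /\
   ('E_P[fun w => (enorm (I w - step_int W (N l) (tau l) (v l) w) ^+ 2)%R] < e%:E)%E.
  have [l _ Hl] := filterI (near0_lt _ _ e0 H1) (near0_lt _ _ e0 H2).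
  by exists l; have [] := Hl l (leqnn l).
exists (N l), (tau l), (v l); split; first exact: Ht.
  exact: ltW.
apply/ltW; move: L2; rewrite unlock.
by under eq_integral do rewrite enorm_sqr.
Qed.

Lemma step_fun_out N tau v c s : step_times N tau c -> ~~ (0 < s <= c) ->
  @step_fun R d m N tau v s = 0.
Proof.
move=> H Hs; rewrite /step_fun big1 // => k _.
have [t0 t1 t2] := H k (ltn_ord k).
rewrite indicE mem_setE in_itv /=; case: andP => [[s1 s2]|]; last by rewrite scale0r.
by case/negP: Hs; rewrite (le_lt_trans t0 s1) (le_trans s2 t2).
Qed.

Lemma measurable_err N tau v c : c <= 1 ->
  measurable_fun (`[0, c] : set R) (err N tau v).
Proof.
move=> c1.
have -> : err N tau v = (fun s => \sum_i \sum_j (step_fun N tau v s - sigma s) i j ^+ 2).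
  by apply/funext => s; exact: tr_gram.
apply: measurable_sum => i; apply: measurable_sum => j.
suff mD : measurable_fun (`[0, c] : set R)
    (fun s => (step_fun N tau v s - sigma s) i j) by exact: measurable_funX.
have -> : (fun s => (step_fun N tau v s - sigma s) i j) =
    (fun s => \sum_(k < N) \1_(`]tau k, tau k.+1]) s * v k i j - sigma s i j).
  apply/funext => s; rewrite !mxE summxE; congr (_ - _).
  by apply: eq_bigr => k _; rewrite mxE.
apply: measurable_funB.
  apply: measurable_sum => k.
  by apply: measurable_funM => //; exact: measurable_indic.
have [mS _] := volS; apply: measurable_funS (mS i j) => //.
by apply: subset_itvl; rewrite bnd_simp.
Qed.

Lemma dotr_trmul (D : 'M[R]_(d, m)) q :
  dotr (q^T *m D) (q^T *m D) = sqn (D^T *m q).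
Proof.
have -> : q^T *m D = (D^T *m q)^T by rewrite trmx_mul trmxK.
by move: (_ *m q) => u; apply: eq_bigr => i _; rewrite mxE expr2.
Qed.

Lemma measurable_step_int N tau (v : nat -> 'M[R]_(d, m)) c : step_times N tau c ->
  measurable_vec (step_int W N tau v).
Proof.
move=> H; apply: measurable_vec_sum => k; apply: measurable_vec_mulmx.
have [t0 t1 _] := H k (ltn_ord k).
apply: measurable_vecB => i; apply: (bm_measurable_fun filF bmW) => //.
exact: le_trans t1.
Qed.

(** By the isometry the left side is an integral of the squared difference of two projected step
    functions. Up to time [a] both approximate [sigma] and nearly cancel; after [a] the second one
    is zero and the first is compared with [sigma], whose projection has squared length at most
    K. *)
Lemma step_int_difference a c q K e N N' tau tau' v v' :
  0 <= a -> a <= c -> c <= 1 -> sqn q <= 1 -> 0 <= K ->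
  (forall s, a <= s <= c -> qform (spot_cov sigma s) q <= K) ->
  step_times N tau c -> step_times N' tau' a ->
  (\int[mu]_(s in `[0%R, c]) (err N tau v s)%:E <= e%:E)%E ->
  (\int[mu]_(s in `[0%R, a]) (err N' tau' v' s)%:E <= e%:E)%E ->
  (\int[P]_w (((q^T *m (step_int W N tau v w - step_int W N' tau' v' w))
     ord0 ord0) ^+ 2)%:E
   <= (fine normal_variance * (2 * K * (c - a) + 4 * e))%:E)%E.
Proof.
move=> a0 ac c1 q1 K0 HK Ht Ht' He He'.
have c0 := le_trans a0 ac; have a1 := le_trans ac c1.
pose p : (Omega -> R) * (R -> 'rV[R]_m) :=
  (fun w => (-1) * (step_pair (W := W) q N' tau' v').1 w + (step_pair (W := W) q N tau v).1 w,
   fun s => (-1) *: (step_pair (W := W) q N' tau' v').2 s + (step_pair (W := W) q N tau v).2 s).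
have gp t i : 0 <= t -> isometric (P := P) p (bm_coord (W := W) t i).
  move=> t0; apply: isometric_lin; apply: isometric_step_pairl;
    try eassumption; move=> s j s0; exact: (isometric_bm_coord filF bmW).
(* Bilinearity is used twice: [gp] treats p against the Brownian coordinates, and after exchanging
   the arguments p itself can stand on the right. *)
have [ip iphi E] : isometric (P := P) p p.
  by apply: isometric_lin; apply: isometric_step_pairl; try eassumption;
    move=> s j s0; apply/isometric_sym/gp.
have p1E w : p.1 w = (q^T *m (step_int W N tau v w - step_int W N' tau' v' w)) ord0 ord0.
  by rewrite /p /= mulmxBr !mxE mulN1r addrC.
have p2E s : p.2 s = q^T *m (step_fun N tau v s - step_fun N' tau' v' s).
  by rewrite /p /= mulmxBr scaleN1r addrC.
have Efin : (\int[P]_w (p.1 w * p.1 w)%:E = (\int[P]_w (p.1 w * p.1 w))%:E)%E.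
  by rewrite /Rintegral fineK //; exact: integrable_fin_num.
have Fin : (\int[mu]_s (dotr (p.2 s) (p.2 s))%:E = (\int[mu]_s (dotr (p.2 s) (p.2 s)))%:E)%E.
  by rewrite /Rintegral fineK //; exact: integrable_fin_num.
under eq_integral do rewrite -p1E expr2.
rewrite Efin E EFinM -Fin EFinM lee_wpmul2l //.
  by rewrite lee_fin fine_ge0 // normal_variance_ge0.
(* [h1] and [h2] pay for the two approximation errors, [h3] for [sigma] itself on []a, c]]; the
   factor 2 is that of [sqnD_le]. *)
set h1 : R -> \bar R := (fun s => (2 * err N tau v s)%:E) \_ `[0, c].
set h2 : R -> \bar R := (fun s => (2 * err N' tau' v' s)%:E) \_ `[0, a].
set h3 : R -> \bar R := (fun s => (2 * K)%:E) \_ `]a, c].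
have errge0 M t u s : 0 <= err M t u s.
  by rewrite /err tr_gram; do 2! (apply: sumr_ge0 => ? _); rewrite sqr_ge0.
have h10 s : (0 <= h1 s)%E.
  by rewrite /h1 patchE; case: ifP => // _; rewrite lee_fin mulr_ge0.
have h20 s : (0 <= h2 s)%E.
  by rewrite /h2 patchE; case: ifP => // _; rewrite lee_fin mulr_ge0.
have h30 s : (0 <= h3 s)%E.
  by rewrite /h3 patchE; case: ifP => // _; rewrite lee_fin mulr_ge0.
have m1 : measurable_fun setT h1.
  apply/(measurable_restrictT _ _).1 => //; apply/measurable_EFinP.
  by apply: measurable_funM => //; exact: measurable_err.
have m2 : measurable_fun setT h2.
  apply/(measurable_restrictT _ _).1 => //; apply/measurable_EFinP.
  by apply: measurable_funM => //; exact: measurable_err.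
have m3 : measurable_fun setT h3.
  by apply/(measurable_restrictT _ _).1.
have key s : ((dotr (p.2 s) (p.2 s))%:E <= h1 s + (h2 s + h3 s))%E.
  rewrite p2E dotr_trmul.
  have [sc|sc] := boolP (0 < s <= c); last first.
    rewrite (step_fun_out _ _ _ _ _ Ht) // (step_fun_out _ _ _ _ _ Ht').
      rewrite subr0 trmx0 mul0mx /sqn big1 ?adde_ge0 // => i _.
      by rewrite mxE expr0n.
    by apply: contra sc => /andP[-> /le_trans]; apply.
  case/andP: sc => s0 sc.
  have -> : h1 s = (2 * err N tau v s)%:E.
    by rewrite /h1 patchE mem_setE in_itv /= (ltW s0) sc.
  have [sa|sa] := leP s a.
    have -> : h2 s = (2 * err N' tau' v' s)%:E.
      by rewrite /h2 patchE mem_setE in_itv /= (ltW s0) sa.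
    have -> : h3 s = 0%E.
      by rewrite /h3 patchE mem_setE in_itv /= ltNge sa.
    rewrite adde0 -EFinD lee_fin.
    have -> : (step_fun N tau v s - step_fun N' tau' v' s)^T *m q =
        (step_fun N tau v s - sigma s)^T *m q +
        - ((step_fun N' tau' v' s - sigma s)^T *m q).
      by rewrite -mulNmx -mulmxDl -!linearN -linearD /= opprB addrA subrK.
    apply: le_trans (sqnD_le _ _) _; rewrite sqnN.
    by apply: lerD; rewrite ler_pM2l // sqn_trmul_le.
  have -> : h2 s = 0%E.
    by rewrite /h2 patchE mem_setE in_itv /= (leNgt s a) sa andbF.
  have -> : h3 s = (2 * K)%:E.
    by rewrite /h3 patchE mem_setE in_itv /= sa sc.
  rewrite add0e -EFinD lee_fin.
  rewrite (step_fun_out _ _ v' _ _ Ht'); last by rewrite (leNgt s a) sa andbF.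
  rewrite subr0 -{1}(subrK (sigma s) (step_fun N tau v s)) linearD /= mulmxDl.
  apply: le_trans (sqnD_le _ _) _.
  apply: lerD; rewrite ler_pM2l //; first exact: sqn_trmul_le.
  by rewrite -qform_gram; apply: HK; rewrite (ltW sa).
apply: (@le_trans _ _ (\int[mu]_s (h1 s + (h2 s + h3 s)))%E).
  apply: ge0_le_integral => //.
  - by move=> s _; rewrite lee_fin p2E dotr_trmul sqn_ge0.
  - exact: measurable_int iphi.
  - by do 2! apply: emeasurable_funD => //.
rewrite !ge0_integralD //; last 2 first.
- by move=> s _; exact: adde_ge0.
- exact: emeasurable_funD.
rewrite /h1 /h2 /h3 -!integral_mkcond.
have I1 (M : nat) t u b : 0 <= b -> b <= 1 ->
    (\int[mu]_(s in `[0%R, b]) (err M t u s)%:E <= e%:E)%E ->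
    (\int[mu]_(s in `[0%R, b]) (2 * err M t u s)%:E <= (2 * e)%:E)%E.
  move=> b0 b1 Hb; under eq_integral do rewrite EFinM.
  rewrite ge0_integralZl //=.
  - by rewrite EFinM lee_wpmul2l.
  - by apply/measurable_EFinP; exact: measurable_err.
  - by move=> s _; rewrite lee_fin.
rewrite integral_cst // [X in (_ + (_ + _ * X))%E]lebesgue_measure_itv /= lte_fin.
have -> : ((2 * K)%:E * (if (a < c)%R then c%:E - a%:E else 0) = (2 * K * (c - a))%:E)%E.
  case: ifP => [_|/negbT]; first by rewrite -EFinD -EFinM.
  rewrite -leNgt => ca; have -> : c = a by apply/eqP; rewrite eq_le ca.
  by rewrite subrr mulr0 mule0.
have -> : (2 * K * (c - a) + 4 * e)%:E = ((2 * e)%:E + ((2 * e)%:E + (2 * K * (c - a))%:E))%E.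
  by rewrite -!EFinD; congr EFin; ring.
by apply: leeD; [exact: I1|apply: leeD => //; exact: I1].
Qed.

(** The increment is a difference of step integrals plus two L2 errors. The square of a sum of three
    terms costs a factor 3, which with the 2 of [step_int_difference] gives 6. *)
Lemma ito_increment_sqr_le a c q K I I' :
  0 <= a -> a <= c -> c <= 1 -> sqn q <= 1 -> 0 <= K ->
  (forall s, a <= s <= c -> qform (spot_cov sigma s) q <= K) ->
  ito_integral P W c sigma I -> ito_integral P W a sigma I' ->
  (\int[P]_w (((q^T *m (I w - I' w)) ord0 ord0) ^+ 2)%:E
   <= (6 * fine normal_variance * K * (c - a))%:E)%E.
Proof.
move=> a0 ac c1 q1 K0 HK HI HI'; apply/lee_addgt0Pr => e e0.
set nv := fine _; have nv0 : 0 <= nv by rewrite fine_ge0 // normal_variance_ge0.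
(* The errors add up to 3 e' + 3 e' + 3 nv 4 e' = e. *)
set e' := e / (6 + 12 * nv).
have den0 : 0 < 6 + 12 * nv by rewrite ltr_pwDl // mulr_ge0.
have e'0 : 0 < e' by rewrite divr_gt0.
have [N [tau [v [Ht He HE]]]] := ito_integral_approx c I e' e'0 HI.
have [N' [tau' [v' [Ht' He' HE']]]] := ito_integral_approx a I' e' e'0 HI'.
have HS := step_int_difference a c q K e' N N' tau tau' v v' a0 ac c1 q1 K0 HK Ht Ht' He He'.
set S := step_int W N tau v in HE HS *; set S' := step_int W N' tau' v' in HE' HS *.
have mI : measurable_vec I by move=> i; apply: measurable_wrt_component; case: HI.
have mI' : measurable_vec I' by move=> i; apply: measurable_wrt_component; case: HI'.
have mS : measurable_vec S by exact: measurable_step_int Ht.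
have mS' : measurable_vec S' by exact: measurable_step_int Ht'.
set f1 := fun w => (3 * sqn (I w - S w))%:E.
set f2 := fun w => (3 * sqn (I' w - S' w))%:E.
set f3 := fun w => (3 * ((q^T *m (S w - S' w)) ord0 ord0) ^+ 2)%:E.
have m1 : measurable_fun setT f1.
  by apply/measurable_EFinP/measurable_funM => //; apply/measurable_sqn/measurable_vecB.
have m2 : measurable_fun setT f2.
  by apply/measurable_EFinP/measurable_funM => //; apply/measurable_sqn/measurable_vecB.
have m3' : measurable_fun setT (fun w => ((q^T *m (S w - S' w)) ord0 ord0) ^+ 2).
  by apply: measurable_funX; apply/measurable_vec_mulmx/measurable_vecB.
have m3 : measurable_fun setT f3.
  by apply/measurable_EFinP/measurable_funM.
have f10 w : (0 <= f1 w)%E by rewrite lee_fin mulr_ge0 // sqn_ge0.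
have f20 w : (0 <= f2 w)%E by rewrite lee_fin mulr_ge0 // sqn_ge0.
have f30 w : (0 <= f3 w)%E by rewrite lee_fin mulr_ge0 // sqr_ge0.
apply: (@le_trans _ _ (\int[P]_w (f1 w + (f2 w + f3 w)))%E).
  apply: ge0_le_integral => //.
  - by move=> w _; rewrite lee_fin sqr_ge0.
  - apply/measurable_EFinP/measurable_funX.
    by apply/measurable_vec_mulmx/measurable_vecB.
  - by do 2! apply: emeasurable_funD => //.
  move=> w _; rewrite /f1 /f2 /f3 -!EFinD lee_fin.
  have -> : I w - I' w = (I w - S w) + (S w - S' w) - (I' w - S' w).
    by apply/matrixP => i j; rewrite !mxE; ring.
  have CS u : ((q^T *m u) ord0 ord0) ^+ 2 <= sqn u.
    apply: le_trans (dot_cauchy_schwarz _ _) _.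
    by rewrite ler_piMl // sqn_ge0.
  rewrite mulmxBr mulmxDr [X in X ^+ 2]mxE [X in (X + _) ^+ 2]mxE [X in (_ + X) ^+ 2]mxE.
  have := CS (I w - S w); have := CS (I' w - S' w).
  move: (sqn (I w - S w)) (sqn (I' w - S' w)) => x y.
  move: ((q^T *m (I w - S w)) _ _) ((q^T *m (I' w - S' w)) _ _)
    ((q^T *m (S w - S' w)) _ _) => u1 u2 u3 H2 H1.
  have -> : (u1 + u3 - u2) ^+ 2 = 3 * u1 ^+ 2 + 3 * u2 ^+ 2 + 3 * u3 ^+ 2
      - ((u1 - u3) ^+ 2 + (u1 + u2) ^+ 2 + (u2 + u3) ^+ 2) by ring.
  have := sqr_ge0 (u1 - u3); have := sqr_ge0 (u1 + u2).
  have := sqr_ge0 (u2 + u3); lra.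
rewrite !ge0_integralD //; last 2 first.
- by move=> w _; exact: adde_ge0.
- exact: emeasurable_funD.
have Z (g : Omega -> R) b : measurable_fun setT g -> (forall w, 0 <= g w) ->
   (\int[P]_w (g w)%:E <= b%:E)%E -> (\int[P]_w (3 * g w)%:E <= (3 * b)%:E)%E.
  move=> mg g0 Hb; under eq_integral do rewrite EFinM.
  rewrite ge0_integralZl //=; first by rewrite EFinM lee_wpmul2l.
  - exact/measurable_EFinP.
  - by move=> w _; rewrite lee_fin.
have -> : ((6 * nv * K * (c - a))%:E + e%:E =
    (3 * e')%:E + ((3 * e')%:E + (3 * (nv * (2 * K * (c - a) + 4 * e')))%:E))%E.
  rewrite -!EFinD; congr EFin.
  have -> : e = e' * (6 + 12 * nv) by rewrite /e' divfK // gt_eqF.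
  ring.
apply: leeD; first by apply: Z => // [|w]; [apply/measurable_sqn/measurable_vecB|exact: sqn_ge0].
apply: leeD; first by apply: Z => // [|w]; [apply/measurable_sqn/measurable_vecB|exact: sqn_ge0].
by apply: Z => // w; exact: sqr_ge0.
Qed.

End ItoIncrement.

(** * The oscillation of the drift over a block *)

Lemma patch_strip {T1 T2 : Type} {V : pointedType} (A : set T1) (f : T1 * T2 -> V) s w :
  (f \_ (A `*` setT)) (s, w) = ((fun s => f (s, w)) \_ A) s.
Proof.
rewrite !patchE; congr (if _ then _ else _).
by apply/idP/idP => [/set_mem[As _]|/set_mem As]; apply/mem_set.
Qed.

Section Drift.
Context {R : realType} {disp : measure_display} {Omega : measurableType disp}.
Context {P : probability Omega R} {F : R -> set (set Omega)} {d : nat}.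
Context {b : R -> Omega -> 'cV[R]_d}.
Hypothesis filF : filtration F.
Hypothesis admb : admissible_drift P F b.
Local Notation mu := (@lebesgue_measure R).
Let T := measurableTypeR R.

Lemma integrable_cst_fin (D : set T) (l r : R) :
  measurable D -> mu D = l%:E -> mu.-integrable D (fun=> r%:E).
Proof.
move=> mD muD; apply/integrableP; split=> //.
by rewrite integral_cst // [X in (_ * X)%E]muD ltry.
Qed.

(** Integrate [2 m f <= f ^ 2 + m ^ 2] with m the mean of f over D; if the right side is infinite
    there is nothing to prove. *)
Lemma Rintegral_sqr_le (D : set T) (f : R -> R) (l : R) :
  measurable D -> 0 < l -> mu D = l%:E ->
  mu.-integrable D (fun s => (f s)%:E) ->
  (((\int[mu]_(s in D) f s) ^+ 2)%:E <= l%:E * \int[mu]_(s in D) (f s ^+ 2)%:E)%E.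
Proof.
move=> mD l0 muD intf; set M := Rintegral _ _ _.
have mf : measurable_fun D f by apply/measurable_EFinP; exact: measurable_int intf.
have mf2 : measurable_fun D (fun s => (f s ^+ 2)%:E).
  by apply/measurable_EFinP; exact: measurable_funX.
have f20 : (0 <= \int[mu]_(s in D) (f s ^+ 2)%:E)%E.
  by apply: integral_ge0 => s _; rewrite lee_fin sqr_ge0.
have [fy|fy] := eqVneq (\int[mu]_(s in D) (f s ^+ 2)%:E)%E +oo%E.
  by rewrite fy gt0_muley ?leey // lte_fin.
have intf2 : mu.-integrable D (fun s => (f s ^+ 2)%:E).
  apply/integrableP; split=> //.
  by under eq_integral do rewrite gee0_abs ?lee_fin ?sqr_ge0 //; rewrite lt_neqAle fy leey.
have intc (r : R) : mu.-integrable D (cst r%:E) by exact: integrable_cst_fin muD.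
set m := M / l.
have : (\int[mu]_(s in D) ((2 * m)%:E * (f s)%:E) <=
        \int[mu]_(s in D) ((f s ^+ 2)%:E + cst (m ^+ 2)%:E s))%E.
  apply: le_integral => //; first exact: integrableZl.
    exact: integrableD.
  move=> s _; rewrite /cst -EFinM -EFinD lee_fin.
  by have := sqr_ge0 (f s - m); rewrite sqrrB; lra.
rewrite integralZl // integralD // integral_cst // [X in (_ + _ * X)%E]muD.
have -> : (\int[mu]_(s in D) (f s)%:E = M%:E)%E.
  by rewrite /M /Rintegral fineK //; exact: integrable_fin_num.
have fi2 : (\int[mu]_(s in D) (f s ^+ 2)%:E)%E \is a fin_num.
  exact: integrable_fin_num.
rewrite -(fineK fi2); move: (fine _) => q; rewrite -!EFinM -EFinD !lee_fin => H.
have E : M = m * l by rewrite /m divfK // gt_eqF.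
move: H; rewrite E => H; have : 0 <= l * (q + m ^+ 2 * l - 2 * m * (m * l)).
  by rewrite mulr_ge0 ?(ltW l0) // subr_ge0.
by rewrite -subr_ge0; congr (_ <= _); ring.
Qed.

Lemma drift_measurable t : 0 <= t <= 1 -> measurable_vec (b t).
Proof.
move=> t01 i; apply: measurable_wrt_component.
have [_ Fm _] := filF; have [bm _ _] := admb.
apply: subset_trans (bm _ t01) (Fm _ _); by case/andP: t01.
Qed.

Let D01 : set (T * Omega) := (`[0, 1] : set T) `*` setT.

Lemma drift_section_measurable w i :
  measurable_fun (`[0, 1] : set T) (fun s : T => b s w i ord0).
Proof.
have [_ mb _] := admb.
have mD01 : measurable D01 by exact: measurableX.
have := (measurable_restrictT _ mD01).1 (mb i) => mg.
have mI : measurable (`[0, 1] : set T) by [].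
apply: (measurable_restrictT (fun s : T => b s w i ord0) mI).2.
have -> : (fun s : T => b s w i ord0) \_ `[0, 1] =
   ((fun z : T * Omega => b z.1 z.2 i ord0) \_ D01) \o (fun s => (s, w)).
  by apply/funext => s; rewrite /= patch_strip.
by apply: measurableT_comp => //; exact: pair2_measurable.
Qed.

(** By Tonelli the pathwise integral of the norm is a random variable of finite mean, hence almost
    surely finite; it dominates each coordinate. *)
Lemma drift_ae_integrable : {ae P, forall w, forall i,
  mu.-integrable (`[0, 1] : set T) (fun s => (b s w i ord0)%:E)}.
Proof.
have [_ mb fb] := admb.
have mD01 : measurable D01 by exact: measurableX.
pose f := (fun z : T * Omega => (enorm (b z.1 z.2))%:E) \_ D01.
have mf : measurable_fun setT f.
  apply: (measurable_restrictT (fun z : T * Omega => (enorm (b z.1 z.2))%:E) mD01).1.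
  apply/measurable_EFinP.
  apply: measurableT_comp; first exact: continuous_measurable_fun (@sqrt_continuous R).
  by apply: measurable_sum => i; apply: measurable_funX; exact: mb.
have f0 z : (0 <= f z)%E.
  by rewrite /f patchE; case: ifP => // _; rewrite lee_fin enorm_ge0.
have fE w : (\int[mu]_(s in `[0%R, 1%R]) (enorm (b s w))%:E = \int[mu]_s f (s, w))%E.
  rewrite integral_mkcond; apply: eq_integral => s _; by rewrite /f patch_strip.
pose G := fun w => (\int[mu]_s f (s, w))%E.
have G0 w : (0 <= G w)%E by apply: integral_ge0.
have mG : measurable_fun setT G by exact: (measurable_fun_fubini_tonelli_G (m1 := mu) f mf f0).
have iG : P.-integrable setT G.
  apply/integrableP; split=> //.
  under eq_integral do rewrite gee0_abs // -/(G _) /G -fE.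
  exact: fb.
apply: filterS (integrable_ae measurableT iG) => w /(_ I) Gw i.
apply/integrableP; split.
  by apply/measurable_EFinP; exact: drift_section_measurable.
apply: (@le_lt_trans _ _ (G w)); last by rewrite -ge0_fin_numE.
rewrite /G -fE; apply: ge0_le_integral => //.
- apply: measurableT_comp => //.
  by apply/measurable_EFinP; exact: drift_section_measurable.
- apply/measurable_EFinP; apply: measurableT_comp; first exact: continuous_measurable_fun (@sqrt_continuous R).
  by apply: measurable_sum => j; apply: measurable_funX; exact: drift_section_measurable.
move=> s _; rewrite /= lee_fin -sqrtr_sqr ler_wsqrtr //.
by rewrite (bigD1 i) //= lerDl sumr_ge0 // => j _; rewrite sqr_ge0.
Qed.

Definition drift_energy (t0 a c : R) (w : Omega) : \bar R :=
  (\int[mu]_(s in `]a, c]) (sqn (b s w - b t0 w))%:E)%E.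

(** On an integrable path the two integrals differ by the one over []a, c]], and [(c - a) *: b t0]
    moves under it as a constant. Cauchy-Schwarz is then applied in each coordinate. *)
Lemma drift_integral_sqr_le t0 a c q :
  0 <= a -> a < c -> c <= 1 -> sqn q <= 1 ->
  {ae P, forall w,
    ((((q^T *m (\col_i (\int[mu]_(s in `[0%R, c]) b s w i ord0)
       - \col_i (\int[mu]_(s in `[0%R, a]) b s w i ord0)
       - (c - a) *: b t0 w)) ord0 ord0) ^+ 2)%:E
      <= (c - a)%:E * drift_energy t0 a c w)%E}.
Proof.
move=> a0 ac c1 q1; apply: filterS drift_ae_integrable => w intb.
have c0 := le_lt_trans a0 ac.
pose D := ([set` `]a, c]] : set T).
have mD : measurable D by exact: measurable_itv.
have D1 : D `<=` (`[0, 1] : set T).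
  by move=> s; rewrite /D /= !in_itv /= => /andP[/ltW/(le_trans a0) -> /le_trans ->].
have muD : mu D = (c - a)%:E.
  by rewrite lebesgue_measure_itv /= lte_fin ac.
set x := _ - _ - _.
have xE i : x i ord0 = \int[mu]_(s in D) (b s w i ord0 - b t0 w i ord0).
  have iD : mu.-integrable D (EFin \o (fun s => b s w i ord0)).
    exact: integrableS (intb i).
  rewrite RintegralB //; last exact: integrable_cst_fin muD.
  rewrite Rintegral_cst // [X in fine X]muD /= mulrC.
  rewrite /x !mxE; congr (_ - _).
  have intc : mu.-integrable `[0, c] (EFin \o (fun s => b s w i ord0)).
    apply: integrableS (intb i) => //.
    by apply: subset_itvl; rewrite bnd_simp.
  by rewrite -(Rintegral_itvB intc) ?bnd_simp //= ?(ltW ac).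
apply: (@le_trans _ _ (sqn x)%:E).
  rewrite lee_fin; apply: le_trans (dot_cauchy_schwarz _ _) _.
  by rewrite ler_piMl // sqn_ge0.
have mb' i : measurable_fun D (fun s => b s w i ord0 - b t0 w i ord0).
  apply: measurable_funB => //.
  by apply: measurable_funS (drift_section_measurable w i).
have -> : drift_energy t0 a c w =
   (\sum_i \int[mu]_(s in D) ((b s w i ord0 - b t0 w i ord0) ^+ 2)%:E)%E.
  rewrite -ge0_integral_sum //.
  - apply: eq_integral => s _; rewrite sumEFin /sqn; congr EFin.
    by apply: eq_bigr => i _; rewrite !mxE.
  - by move=> i; apply/measurable_EFinP; apply: measurable_funX.
  - by move=> i s _; rewrite lee_fin sqr_ge0.
rewrite ge0_sume_distrr; last first.
  by move=> i _; apply: integral_ge0 => s _; rewrite lee_fin sqr_ge0.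
rewrite /sqn -sumEFin; apply: lee_sum => i _; rewrite xE.
apply: Rintegral_sqr_le => //; first by rewrite subr_gt0.
have -> : (fun s => (b s w i ord0 - b t0 w i ord0)%:E) =
  (fun s => (b s w i ord0)%:E - cst (b t0 w i ord0)%:E s)%E by [].
apply: integrableB => //.
  exact: integrableS (intb i).
exact: integrable_cst_fin muD.
Qed.

(** With S the squared norm, take expectations in [2 del S <= S ^ 2 + del ^ 2] and divide by
    [2 del]. *)
Lemma Lnorm4_sqr_le (V : Omega -> 'cV[R]_d) (K : R) :
  measurable_vec V -> 0 <= K ->
  ('N[P]_4%:E[(fun w => (enorm (V w))%:E)] <= K%:E)%E ->
  (\int[P]_w (sqn (V w))%:E <= (K ^+ 2)%:E)%E.
Proof.
move=> mV K0 HK.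
have H4 : (\int[P]_w (sqn (V w) ^+ 2)%:E <= (K ^+ 4)%:E)%E.
  have -> : (\int[P]_w (sqn (V w) ^+ 2)%:E = \int[P]_w (`| (enorm (V w))%:E | `^ 4))%E.
    apply: eq_integral => w _; rewrite gee0_abs ?lee_fin ?enorm_ge0 // poweR_EFin.
    by rewrite powR_mulrn ?enorm_ge0 // -enorm_sqr -exprM.
  rewrite -powR_Lnorm //.
  have -> : (K ^+ 4)%:E = (K%:E `^ 4)%E by rewrite poweR_EFin powR_mulrn.
  apply: gt0_ler_poweR => //; rewrite in_itv /= leey andbT ?lee_fin //.
  exact: Lnorm_ge0.
apply/lee_addgt0Pr => e e0.
(* The added e keeps the divisor positive when K = 0. *)
set del := K ^+ 2 + e.
have del0 : 0 < del by rewrite ltr_wpDl // sqr_ge0.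
have mS : measurable_fun setT (fun w => sqn (V w)) by exact: measurable_sqn.
have : ((2 * del)%:E * \int[P]_w (sqn (V w))%:E <=
   \int[P]_w ((sqn (V w) ^+ 2)%:E + (del ^+ 2)%:E))%E.
  rewrite -ge0_integralZl //.
  - apply: ge0_le_integral => //.
    + by move=> w _; rewrite -EFinM lee_fin mulr_ge0 ?sqn_ge0 ?mulr_ge0 ?(ltW del0).
    + by apply: emeasurable_funM => //; exact/measurable_EFinP.
    + by apply: emeasurable_funD => //; apply/measurable_EFinP; exact: measurable_funX.
    + move=> w _; rewrite -EFinM -EFinD lee_fin.
      by have := sqr_ge0 (sqn (V w) - del); rewrite sqrrB; lra.
  - exact/measurable_EFinP.
  - by move=> w _; rewrite lee_fin sqn_ge0.
  - by rewrite lee_fin mulr_ge0 // ltW.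
rewrite ge0_integralD //; last 3 first.
- by move=> w _; rewrite lee_fin sqr_ge0.
- by apply/measurable_EFinP; exact: measurable_funX.
- by move=> w _; rewrite lee_fin sqr_ge0.
rewrite integral_cst //= [X in (_ + _ * X)%E]probability_setT mule1 => H.
have {}H := le_trans H (leeD2r _ H4).
have K4 : K ^+ 4 <= del ^+ 2.
  rewrite (exprM K 2 2) ler_pXn2r ?nnegrE ?sqr_ge0 ?(ltW del0) //.
  by rewrite /del lerDl ltW.
have {}H : ((2 * del)%:E * \int[P]_w (sqn (V w))%:E <= (2 * del)%:E * del%:E)%E.
  apply: le_trans H _; rewrite -EFinD -EFinM lee_fin.
  by move: K4; rewrite !expr2; lra.
by move: H; rewrite lee_pmul2l ?lte_fin ?mulr_gt0 // /del EFinD.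
Qed.

(** Tonelli exchanges time and expectation; at each time s the Hölder condition applies with
    [s - t0 <= h]. *)
Lemma drift_energy_le beta L t0 a c h :
  holder_drift P F beta L b -> 0 < beta -> 0 <= L ->
  0 <= t0 -> t0 <= a -> a <= c -> c <= 1 -> c - t0 <= h ->
  measurable_fun setT (drift_energy t0 a c) /\
  (\int[P]_w drift_energy t0 a c w <= ((L * h `^ beta) ^+ 2 * (c - a))%:E)%E.
Proof.
move=> [_ Hb] beta0 L0 t00 ta ac c1 ch.
have [_ mb _] := admb.
pose D : set (T * Omega) := (`]a, c] : set T) `*` setT.
have mD : measurable D by exact: measurableX.
have D1 : D `<=` D01.
  move=> [s w] [/= + _]; rewrite in_itv /= => /andP[s1 s2]; split => //=.
  by rewrite in_itv /= (le_trans s2 c1) andbT (le_trans t00) // (le_trans ta) // ltW.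
have t01 : 0 <= t0 <= 1 by rewrite t00 (le_trans ta) // (le_trans ac).
pose f := (fun z : T * Omega => (sqn (b z.1 z.2 - b t0 z.2))%:E) \_ D.
have mf : measurable_fun setT f.
  apply: (measurable_restrictT
    (fun z : T * Omega => (sqn (b z.1 z.2 - b t0 z.2))%:E) mD).1.
  apply/measurable_EFinP.
  apply: measurable_sum => i; apply: measurable_funX.
  have -> : (fun z : T * Omega => (b z.1 z.2 - b t0 z.2) i ord0) =
    (fun z => b z.1 z.2 i ord0 - b t0 z.2 i ord0).
    by apply/funext => z; rewrite !mxE.
  apply: measurable_funB.
    apply: measurable_funS (mb i) => //; exact: measurableX.
  apply: measurable_funTS.
  exact: (measurableT_comp (drift_measurable t0 t01 i) (@measurable_snd _ _ T Omega)).
have f0 z : (0 <= f z)%E.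
  by rewrite /f patchE; case: ifP => // _; rewrite lee_fin sqn_ge0.
have fE w : drift_energy t0 a c w = (\int[mu]_s f (s, w))%E.
  rewrite /drift_energy integral_mkcond; apply: eq_integral => s _.
  by rewrite /f patch_strip.
have E : drift_energy t0 a c = (fun w => \int[mu]_s f (s, w))%E by apply/funext.
split; first by rewrite E; exact: (measurable_fun_fubini_tonelli_G (m1 := mu) f mf f0).
under eq_integral do rewrite fE.
rewrite -(fubini_tonelli f mf f0).
set K := (L * h `^ beta) ^+ 2.
have h0 : 0 <= h by apply: le_trans ch; rewrite subr_ge0 (le_trans ta).
apply: (@le_trans _ _ (\int[mu]_(s in `]a, c]) K%:E)%E); last first.
  rewrite integral_cst // [X in (_ * X)%E]lebesgue_measure_itv /= lte_fin.
  case: ifP => [_|/negbT]; first by rewrite -EFinD -EFinM.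
  rewrite -leNgt => ca; have -> : c = a by apply/eqP; rewrite eq_le ca.
  by rewrite subrr mulr0 mule0.
rewrite [leRHS]integral_mkcond; apply: ge0_le_integral => //.
- by move=> s _; exact: integral_ge0.
- exact: (measurable_fun_fubini_tonelli_F (m2 := P) f mf f0).
- by apply/(measurable_restrictT _ _).1.
move=> s _; rewrite patchE; case: ifPn => sac; last first.
  rewrite integral0_eq // => w _.
  by rewrite /f patch_strip patchE (negbTE sac).
have {}sac : a < s <= c by move: sac; rewrite inE /= in_itv.
have -> : (\int[P]_w f (s, w) = \int[P]_w (sqn (b s w - b t0 w))%:E)%E.
  apply: eq_integral => w _; rewrite /f patch_strip patchE ifT //.
  by rewrite inE /= in_itv.
case/andP: sac => sa sc.
have s1 : s <= 1 by exact: le_trans c1.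
have ts : t0 <= s by rewrite (le_trans ta) // ltW.
have s01 : 0 <= s <= 1 by rewrite s1 (le_trans t00).
apply: Lnorm4_sqr_le.
- by apply: measurable_vecB; exact: drift_measurable.
- by rewrite mulr_ge0 // powR_ge0.
apply: le_trans (Hb s t0 t00 ts s1) _; rewrite lee_fin ler_wpM2l //.
apply: ge0_ler_powR; rewrite ?nnegrE ?normr_ge0 ?(ltW beta0) //.
by rewrite ger0_norm ?subr_ge0 // (le_trans _ ch) // lerB.
Qed.

End Drift.

(** * Domination of an expectation *)

Section Expectation.
Context {R : realType} {disp : measure_display} {Omega : measurableType disp}.
Variable P : probability Omega R.

(* The test statistic is not known to be measurable here, hence the detour
   through the definition of the integral as a supremum over simple functions. *)
Lemma expectation_le_integral (X Y : Omega -> R) :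
  (forall w, X w <= Y w) -> (forall w, 0 <= Y w) ->
  ('E_P[X] <= \int[P]_w (Y w)%:E)%E.
Proof.
move=> XY Y0; rewrite unlock [leRHS]ge0_integralE; last by move=> w _; rewrite lee_fin.
rewrite [leLHS]integralE.
apply: (@le_trans _ _ (\int[P]_w (fun w => (X w)%:E)^\+%E w)%E).
  rewrite -[leRHS]sube0; apply: leeB => //.
  by apply: integral_ge0 => w _; exact: funeneg_ge0.
rewrite ge0_integralE; last by move=> w _; exact: funepos_ge0.
apply: le_ereal_sup => _ [g gX <-]; exists g => // w.
apply: le_trans (gX w) _; rewrite !patchE in_setT funeposE ge_max !lee_fin.
by rewrite XY Y0.
Qed.

End Expectation.

(** * Second moments of the observed increments *)

Section Increments.
Context {R : realType} {disp : measure_display} {Omega : measurableType disp}.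
Context {P : probability Omega R} {F : R -> set (set Omega)} {d m : nat}.
Context {W : R -> Omega -> 'cV[R]_m} {sigma : R -> 'M[R]_(d, m)}.
Context {b X : R -> Omega -> 'cV[R]_d}.
Hypothesis filF : filtration F.
Hypothesis bmW : brownian_motion P F W.
Hypothesis volS : admissible_volatility sigma.
Hypothesis itoX : ito_process P W b sigma X.
Variables (beta L : R).
Hypothesis Hb : holder_drift P F beta L b.
Hypothesis beta0 : 0 < beta.
Hypothesis L0 : 0 <= L.
Let admb : admissible_drift P F b := Hb.1.

Lemma ito_process_measurable t : 0 <= t <= 1 -> measurable_vec (X t).
Proof.
by move=> t01 i; apply: measurable_wrt_component; have [] := itoX t t01.
Qed.

(** The square of martingale part u plus drift part v is at most 2 u^2 + 2 v^2, which doubles the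
    constant 6 of the martingale estimate. *)
Lemma increment_sqr_le t0 a c h q K :
  0 <= t0 -> t0 <= a -> a < c -> c <= 1 -> c - t0 <= h -> sqn q <= 1 -> 0 <= K ->
  (forall s, a <= s <= c -> qform (spot_cov sigma s) q <= K) ->
  (\int[P]_w (((q^T *m (X c w - X a w - (c - a) *: b t0 w)) ord0 ord0) ^+ 2)%:E
   <= (12 * fine normal_variance * K * (c - a)
       + 2 * (L * h `^ beta) ^+ 2 * (c - a) ^+ 2)%:E)%E.
Proof.
move=> t00 ta ac c1 ch q1 K0 HK.
have a0 := le_trans t00 ta; have a1 := le_trans (ltW ac) c1.
have c0 := le_trans a0 (ltW ac).
have a01 : 0 <= a <= 1 by rewrite a0.
have c01 : 0 <= c <= 1 by rewrite c0.
have t01 : 0 <= t0 <= 1 by rewrite t00 (le_trans ta).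
have [_ [Ia HIa Xa]] := itoX a a01.
have [_ [Ic HIc Xc]] := itoX c c01.
have mIa : measurable_vec Ia by move=> i; apply: measurable_wrt_component; case: HIa.
have mIc : measurable_vec Ic by move=> i; apply: measurable_wrt_component; case: HIc.
have mXa := ito_process_measurable a a01.
have mXc := ito_process_measurable c c01.
have mb : measurable_vec (fun w => (c - a) *: b t0 w).
  move=> i; have -> : (fun w => ((c - a) *: b t0 w) i ord0) =
      (fun w => (c - a) * b t0 w i ord0) by apply/funext => w; rewrite mxE.
  by apply: measurable_funM => //; exact: (drift_measurable filF admb).
have HI := ito_increment_sqr_le filF bmW volS a c q K Ic Ia a0 (ltW ac) c1 q1 K0 HK HIc HIa.
have [mE HE] := drift_energy_le filF admb beta L t0 a c h Hb beta0 L0 t00 ta (ltW ac) c1 ch.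
have HD := drift_integral_sqr_le admb t0 a c q a0 ac c1 q1.
pose u w := (q^T *m (Ic w - Ia w)) ord0 ord0.
(* Defined as a remainder rather than by the drift integral, so that measurability is inherited from
   X, b and the stochastic integrals. *)
pose v w := (q^T *m (X c w - X a w - (c - a) *: b t0 w - (Ic w - Ia w))) ord0 ord0.
have mu_ : measurable_fun setT u by apply/measurable_vec_mulmx/measurable_vecB.
have mv : measurable_fun setT v.
  by apply/measurable_vec_mulmx; do ! apply: measurable_vecB.
have Hu : (\int[P]_w (2 * u w ^+ 2)%:E <= (12 * fine normal_variance * K * (c - a))%:E)%E.
  under eq_integral do rewrite EFinM.
  rewrite ge0_integralZl //.
  - have -> : 12 * fine normal_variance * K * (c - a) =
      2 * (6 * fine normal_variance * K * (c - a)) by ring.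
    by rewrite EFinM lee_wpmul2l.
  - by apply/measurable_EFinP; exact: measurable_funX.
  - by move=> w _; rewrite lee_fin sqr_ge0.
have ca0 : 0 <= c - a by rewrite subr_ge0 ltW.
have E0 w : (0 <= drift_energy (b := b) t0 a c w)%E.
  by apply: integral_ge0 => s _; rewrite lee_fin sqn_ge0.
have Hv : (\int[P]_w (2 * v w ^+ 2)%:E <= (2 * (L * h `^ beta) ^+ 2 * (c - a) ^+ 2)%:E)%E.
  apply: (@le_trans _ _ (\int[P]_w ((2 * (c - a))%:E * drift_energy (b := b) t0 a c w))%E).
    apply: ae_ge0_le_integral => //.
    - by move=> w _; rewrite lee_fin mulr_ge0 // sqr_ge0.
    - by apply/measurable_EFinP/measurable_funM => //; exact: measurable_funX.
    - by move=> w _; rewrite mule_ge0 // lee_fin mulr_ge0.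
    - exact: measurable_funeM.
    (* Off a null set X(0), [Ia] and [Ic] cancel, and v becomes the projected drift integral. *)
    apply: filterS3 HD Xa Xc => w HDw Xaw Xcw _.
    rewrite !EFinM -muleA lee_wpmul2l //.
    apply: le_trans HDw; rewrite lee_fin /v Xaw Xcw le_eqVlt; apply/orP; left.
    apply/eqP; congr ((_ *m _) _ _ ^+ 2).
    by apply/matrixP => i j; rewrite !mxE; ring.
  rewrite ge0_integralZl //; last by rewrite lee_fin mulr_ge0.
  have -> : 2 * (L * h `^ beta) ^+ 2 * (c - a) ^+ 2 =
      2 * (c - a) * ((L * h `^ beta) ^+ 2 * (c - a)) by ring.
  by rewrite [leRHS]EFinM lee_wpmul2l // lee_fin mulr_ge0.
rewrite EFinD; apply: le_trans (leeD Hu Hv).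
rewrite -ge0_integralD //; last 4 first.
- by move=> w _; rewrite lee_fin mulr_ge0 // sqr_ge0.
- by apply/measurable_EFinP/measurable_funM => //; exact: measurable_funX.
- by move=> w _; rewrite lee_fin mulr_ge0 // sqr_ge0.
- by apply/measurable_EFinP/measurable_funM => //; exact: measurable_funX.
apply: ge0_le_integral => //.
- by move=> w _; rewrite lee_fin sqr_ge0.
- apply/measurable_EFinP; apply: measurable_funX; apply/measurable_vec_mulmx.
  by do ! apply: measurable_vecB.
- by apply: emeasurable_funD; apply/measurable_EFinP/measurable_funM => //;
    exact: measurable_funX.
move=> w _; rewrite -EFinD lee_fin.
have -> : (q^T *m (X c w - X a w - (c - a) *: b t0 w)) ord0 ord0 = u w + v w.
  rewrite /u /v; move: (X c w - _ - _) (Ic w - Ia w) => y z.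
  by rewrite -{1}(subrK z y) mulmxDr [LHS]mxE addrC.
by have := sqr_ge0 (u w - v w); rewrite sqrrB sqrrD; lra.
Qed.

End Increments.

(** * Deterministic bounds on one block *)

Section Blocks.
Context {R : realType}.

(** Deviations from the mean M sum to zero, so the two sides differ by exactly [N (M - c)^2]. *)
Lemma sum_sqr_mean_le (N : nat) (x : nat -> R) (c : R) : (0 < N)%N ->
  \sum_(1 <= i < N.+1) (x i - N%:R^-1 * \sum_(1 <= j < N.+1) x j) ^+ 2 <=
  \sum_(1 <= i < N.+1) (x i - c) ^+ 2.
Proof.
move=> N0; set M := N%:R^-1 * _.
have N1 : N%:R != 0 :> R by rewrite pnatr_eq0 -lt0n.
have S0 : \sum_(1 <= i < N.+1) (x i - M) = 0.
  rewrite sumrB sumr_const_nat subn1 /= /M -[_ *+ N]mulr_natl mulrA.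
  by rewrite mulfV // mul1r subrr.
have -> : \sum_(1 <= i < N.+1) (x i - c) ^+ 2 =
    \sum_(1 <= i < N.+1) (x i - M) ^+ 2 + (M - c) ^+ 2 *+ N.
  rewrite -[X in _ *+ X]subn0 -(subSS 0 N) -sumr_const_nat -big_split /=.
  transitivity (\sum_(1 <= i < N.+1)
     (((x i - M) ^+ 2 + (M - c) ^+ 2) + 2 * (M - c) * (x i - M))).
    by apply: eq_bigr => i _; ring.
  by rewrite big_split /= -mulr_sumr S0 mulr0 addr0.
by rewrite lerDl mulrn_wge0 // sqr_ge0.
Qed.

(** The squared norm of column j is the diagonal entry [Q j j], which dominates its own square and
    is thus at most 1. *)
Lemma sqn_projection_col {d} (Q : 'M[R]_d) j : Q^T = Q -> Q *m Q = Q ->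
  sqn (col j Q) <= 1.
Proof.
move=> QT QQ; have E : sqn (col j Q) = Q j j.
  rewrite -{2}QQ mxE; apply: eq_bigr => i _; rewrite mxE expr2; congr (_ * _).
  by rewrite -{1}QT mxE.
have H : Q j j ^+ 2 <= Q j j.
  rewrite -{2}E /sqn (bigD1 j) //= mxE lerDl sumr_ge0 // => i _.
  exact: sqr_ge0.
rewrite E; have [Q0|Q0] := leP (Q j j) 0; first exact: le_trans Q0 ler01.
by move: H; rewrite expr2 ger_pMl.
Qed.

Lemma sqn_mulmx_cols {d} (Q : 'M[R]_d) z : Q^T = Q ->
  sqn (Q *m z) = \sum_j ((col j Q)^T *m z) ord0 ord0 ^+ 2.
Proof.
move=> QT; apply: eq_bigr => j _; congr (_ ^+ 2).
by rewrite -{1}QT !mxE; apply: eq_bigr => i _; rewrite !mxE.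
Qed.

(** For v in the kernel of S, v = Q v, so Q can be moved onto the increment before
    Cauchy-Schwarz. *)
Lemma eigval_Sigma_hat_le {Omega : Type} {d} (X : R -> Omega -> 'cV[R]_d)
    n h k w r (S Q : 'M[R]_d) :
  0 <= h -> (\rank S <= r < d)%N -> Q^T = Q ->
  (forall v : 'cV[R]_d, S *m v = 0 -> Q *m v = v) ->
  eigval r.+1 (Sigma_hat X n h k w) <=
  h^-1 * \sum_(1 <= i < (block_size n h).+1)
    sqn (Q *m (incr X n h k i w
      - (n%:R * h)^-1 *: \sum_(1 <= j < (block_size n h).+1) incr X n h k j w)).
Proof.
move=> h0 rS QT HQ.
set mean := _ *: \sum_(1 <= j < _) _.
have hV0 : 0 <= h^-1 by rewrite invr_ge0.
apply: (eigval_le _ S) => //.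
- rewrite /Sigma_hat linearZ /= raddf_sum /=; congr (_ *: _).
  by apply: eq_bigr => i _; rewrite /tensor2 trmx_mul trmxK.
- by rewrite mulr_ge0 // sumr_ge0 // => i _; exact: sqn_ge0.
move=> v Sv.
have -> : qform (Sigma_hat X n h k w) v =
    h^-1 * \sum_(1 <= i < (block_size n h).+1) qform (tensor2 (incr X n h k i w - mean)) v.
  rewrite /qform /Sigma_hat -scalemxAr -scalemxAl mxE; congr (_ * _).
  rewrite mulmx_sumr mulmx_suml summxE; apply: eq_bigr => i _.
  by [].
rewrite -mulrA ler_wpM2l // mulr_suml; apply: ler_sum => i _.
rewrite qform_tensor2 -{1}(HQ v Sv) mulmxA -[X in X *m v]trmxK trmx_mul trmxK QT.
exact: dot_cauchy_schwarz.
Qed.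

End Blocks.

(** * From one increment to the whole statistic *)

Section TestStatistic.
Context {R : realType} {disp : measure_display} {Omega : measurableType disp}.
Context {P : probability Omega R} {F : R -> set (set Omega)} {d m : nat}.
Context {W : R -> Omega -> 'cV[R]_m} {sigma : R -> 'M[R]_(d, m)}.
Context {b X : R -> Omega -> 'cV[R]_d}.
Hypothesis filF : filtration F.
Hypothesis bmW : brownian_motion P F W.
Hypothesis volS : admissible_volatility sigma.
Hypothesis itoX : ito_process P W b sigma X.
Variables (beta L : R).
Hypothesis Hb : holder_drift P F beta L b.
Hypothesis beta0 : 0 < beta.
Hypothesis L0 : 0 <= L.
Variables (n : nat) (h : R) (r : nat) (K : R).
Hypothesis n0 : (0 < n)%N.
Hypothesis h0 : 0 < h.
Hypothesis nh_nat : n%:R * h \is a Num.nat.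
Hypothesis hV_nat : h^-1 \is a Num.nat.
Hypothesis rd : (r < d)%N.
Hypothesis rankS : forall t, 0 <= t <= 1 -> (\rank (spot_cov sigma t) <= r)%N.
Hypothesis K0 : 0 <= K.
(** The two regimes of the theorem differ only here: K will be [L_Sigma * h^beta_Sigma], or its
    square divided by lam. *)
Hypothesis kerS : forall t s v, 0 <= t -> t <= s -> s <= 1 -> s - t <= h ->
  sqn v <= 1 -> spot_cov sigma t *m v = 0 -> qform (spot_cov sigma s) v <= K.

(** This is [h^-1] times d columns times n h increments times the bound of [increment_sqr_le] for an
    increment of length 1/n. *)
Let C : R := d%:R * (12 * fine normal_variance * K
  + 2 * (L * h `^ beta) ^+ 2 * n%:R^-1).

Lemma block_bound k : (k < Num.truncn h^-1)%N ->
  exists Y : Omega -> R, [/\ measurable_fun setT Y, forall w, 0 <= Y w,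
    forall w, eigval r.+1 (Sigma_hat X n h k w) <= Y w &
    (\int[P]_w (Y w)%:E <= C%:E)%E].
Proof.
move=> kM; set N := block_size n h.
have NE : N%:R = n%:R * h :> R by rewrite /N /block_size truncnK.
have n0R : 0 < n%:R :> R by rewrite ltr0n.
have N0 : (0 < N)%N by rewrite -(ltr0n R) NE mulr_gt0.
set t0 := k%:R * h.
have t00 : 0 <= t0 by rewrite mulr_ge0 // ltW.
have t0h : t0 + h <= 1.
  have : k.+1%:R <= h^-1 :> R by rewrite -[leRHS]truncnK // ler_nat.
  by rewrite -(ler_pM2r h0) mulVf ?gt_eqF // -natr1 mulrDl mul1r.
pose t i : R := t0 + i%:R / n%:R.
have tE i : (0 < i)%N -> t i - t i.-1 = n%:R^-1.
  move=> i0; rewrite /t; have -> : i%:R = i.-1%:R + 1 :> R.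
    by rewrite natr1 prednK.
  by rewrite mulrDl mul1r; ring.
have ti i : (i <= N)%N -> t i - t0 <= h.
  move=> iN; rewrite /t addrC addKr ler_pdivrMr // mulrC -NE ler_nat //.
have ti1 i : (i <= N)%N -> t i <= 1.
  by move=> iN; apply: le_trans t0h; rewrite -lerBlDl ti.
have t0t i : t0 <= t i by rewrite /t lerDl divr_ge0.
have [Q [QT QQ SQ HQ]] := ker_projection (spot_cov sigma t0).
have t01 : 0 <= t0 <= 1 by rewrite t00 (le_trans _ t0h) // lerDl ltW.
pose Z i j w := ((col j Q)^T *m (X (t i) w - X (t i.-1) w - (t i - t i.-1) *: b t0 w)) ord0 ord0 ^+ 2.
have mZ i j : (0 < i < N.+1)%N -> measurable_fun setT (Z i j).
  move=> /andP[i0 iN]; apply: measurable_funX; apply/measurable_vec_mulmx.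
  apply: measurable_vecB; first apply: measurable_vecB.
  - by apply: (ito_process_measurable itoX); rewrite (le_trans t00) ?ti1.
  - apply: (ito_process_measurable itoX); rewrite (le_trans t00) ?ti1 //.
    by rewrite (leq_trans (leq_pred _)).
  - move=> l; have -> : (fun w => ((t i - t i.-1) *: b t0 w) l ord0) =
      (fun w => (t i - t i.-1) * b t0 w l ord0) by apply/funext => w; rewrite mxE.
    by apply: measurable_funM => //; exact: (drift_measurable filF Hb.1).
set cst_ := 12 * fine normal_variance * K * n%:R^-1
       + 2 * (L * h `^ beta) ^+ 2 * n%:R^-1 ^+ 2.
have IZ i j : (0 < i < N.+1)%N -> (\int[P]_w (Z i j w)%:E <= cst_%:E)%E.
  move=> /andP[i0 iN]; rewrite /cst_ -(tE i i0).
  have iN' : (i.-1 <= N)%N by rewrite (leq_trans (leq_pred _)).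
  apply: (increment_sqr_le filF bmW volS itoX beta L Hb beta0 L0) => //.
  - by rewrite -subr_gt0 tE // invr_gt0.
  - exact: ti1.
  - exact: ti.
  - exact: sqn_projection_col.
  move=> s /andP[s1 s2]; apply: (kerS t0) => //.
  - exact: le_trans s1.
  - by apply: le_trans s2 _; exact: ti1.
  - by apply: le_trans (ti i iN); rewrite lerB.
  - exact: sqn_projection_col.
  - by rewrite colE mulmxA SQ mul0mx.
have Z0 i j w : 0 <= Z i j w by exact: sqr_ge0.
have lin (A B : 'M[R]_1) a : (A - a *: B) ord0 ord0 = A ord0 ord0 - a * B ord0 ord0.
  by rewrite !mxE.
pose A w := \sum_j \sum_(i < N) Z i.+1 j w.
have mA : measurable_fun setT A.
  by apply: measurable_sum => j; apply: measurable_sum => i; apply: mZ; rewrite /= ltnS.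
exists (fun w => h^-1 * A w); split.
- exact: measurable_funM.
- by move=> w; rewrite mulr_ge0 ?invr_ge0 ?(ltW h0) // sumr_ge0 // => j _; exact: sumr_ge0.
- move=> w; have := eigval_Sigma_hat_le X n h k w r (spot_cov sigma t0) Q (ltW h0).
  rewrite rankS // rd => /(_ isT QT HQ) /le_trans; apply.
  rewrite ler_wpM2l ?invr_ge0 ?(ltW h0) //.
  under eq_bigr do rewrite sqn_mulmx_cols //.
  rewrite exchange_big /=; apply: ler_sum => j _.
  rewrite -/N; have -> : \sum_(i < N) Z i.+1 j w = \sum_(1 <= i < N.+1) Z i j w.
    by rewrite big_add1 /= big_mkord.
  set y := fun i => ((col j Q)^T *m incr X n h k i w) ord0 ord0.
  apply: (@le_trans _ _ (\sum_(1 <= i < N.+1)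
    (y i - N%:R^-1 * \sum_(1 <= l < N.+1) y l) ^+ 2)).
    rewrite le_eqVlt; apply/orP; left; apply/eqP; apply: eq_bigr => i _.
    by rewrite mulmxBr -scalemxAr mulmx_sumr lin summxE NE.
  apply: le_trans (sum_sqr_mean_le N y (n%:R^-1 * ((col j Q)^T *m b t0 w) ord0 ord0) N0) _.
  rewrite le_eqVlt; apply/orP; left; apply/eqP; apply: eq_big_nat => i /andP[i0 _].
  by rewrite /Z tE // mulmxBr -scalemxAr lin.
- under eq_integral do rewrite EFinM.
  rewrite ge0_integralZl //; last 3 first.
  + exact/measurable_EFinP.
  + by move=> w _; rewrite lee_fin sumr_ge0 // => j _; exact: sumr_ge0.
  + by rewrite lee_fin invr_ge0 ltW.
  have -> : C = h^-1 * (\sum_(j < d) \sum_(i < N) cst_).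
    rewrite !sumr_const !card_ord -mulrnA -mulr_natl natrM NE /C /cst_.
    by field; rewrite !gt_eqF.
  rewrite EFinM lee_wpmul2l ?lee_fin ?invr_ge0 ?(ltW h0) //.
  under eq_integral do rewrite /A -sumEFin.
  rewrite ge0_integral_sum //; last 2 first.
  + move=> j; apply/measurable_EFinP; apply: measurable_sum => i.
    by apply: mZ; rewrite /= ltnS.
  + by move=> j w _; rewrite lee_fin sumr_ge0.
  rewrite -sumEFin; apply: lee_sum => j _.
  under eq_integral do rewrite -sumEFin.
  rewrite ge0_integral_sum //; last 2 first.
  + by move=> i; apply/measurable_EFinP; apply: mZ; rewrite /= ltnS.
  + by move=> i w _; rewrite lee_fin.
  by rewrite -sumEFin; apply: lee_sum => i _; apply: IZ; rewrite /= ltnS.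
Qed.

Lemma expectation_test_stat_le : ('E_P[test_stat X n h r] <= C%:E)%E.
Proof.
set M := Num.truncn h^-1.
have ME : M%:R = h^-1 :> R by rewrite /M truncnK.
have /choice[Y HY] (k : 'I_M) := block_bound k (ltn_ord k).
apply: (@le_trans _ _ (\int[P]_w (\sum_(k < M) h * Y k w)%:E)%E).
  apply: expectation_le_integral => w.
    rewrite /test_stat -/M big_mkord; apply: ler_sum => k _.
    by rewrite ler_pM2l //; have [_ _ ->] := HY k.
  by apply: sumr_ge0 => k _; rewrite mulr_ge0 ?(ltW h0) //; have [_ ->] := HY k.
under eq_integral do rewrite -sumEFin.
rewrite ge0_integral_sum //; last 2 first.
- by move=> k; apply/measurable_EFinP; apply: measurable_funM => //; have [] := HY k.
- by move=> k w _; rewrite lee_fin mulr_ge0 ?(ltW h0) //; have [_ ->] := HY k.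
(* The weights h of the [h^-1] blocks sum to 1, so the average inherits the bound of a single
   block. *)
have -> : C%:E = (\sum_(k < M) (h * C)%:E)%E.
  rewrite sumEFin sumr_const card_ord -mulr_natl ME mulrA mulVf ?mul1r //.
  by rewrite gt_eqF.
apply: lee_sum => k _; have [mY Y0 _ IY] := HY k.
under eq_integral do rewrite EFinM.
rewrite ge0_integralZl //.
- by rewrite EFinM lee_wpmul2l ?lee_fin ?(ltW h0).
- exact/measurable_EFinP.
- by move=> w _; rewrite lee_fin.
- by rewrite lee_fin ltW.
Qed.

End TestStatistic.

(** Arithmetic common to both regimes: e is the dimension, a the normal second moment, s the
    volatility term, q the drift term and q' its weakened form. *)
Lemma weighted_sum_le {R : realType} (e a s q q' : R) :
  0 <= e -> 0 <= a -> 0 <= s -> 0 <= q -> q <= q' ->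
  e * (12 * a * s + 2 * q) <= (e * (12 * a + 2) + 1) * (s + q').
Proof.
move=> e0 a0 s0 q0 qq'; have q'0 := le_trans q0 qq'.
apply: (@le_trans _ _ (e * (12 * a * s + 2 * q'))).
  by rewrite ler_wpM2l // lerD2l ler_pM2l.
rewrite -subr_ge0 (_ : _ - _ = e * (12 * (a * q')) + e * (2 * s) + (s + q')).
  by rewrite !addr_ge0 // !mulr_ge0.
ring.
Qed.

(** * The rates with and without a spectral gap *)

Theorem theorem2p11 (R : realType) (d : nat) :
  exists2 K : R, 0 < K &
  forall (disp : measure_display) (Omega : measurableType disp)
         (P : probability Omega R) (F : R -> set (set Omega))
         (m : nat) (W : R -> Omega -> 'cV[R]_m)
         (b : R -> Omega -> 'cV[R]_d) (sigma : R -> 'M[R]_(d, m))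
         (X : R -> Omega -> 'cV[R]_d)
         (n : nat) (h : R)
         (r : nat) (beta_b beta_Sigma L_b L_Sigma : R),
    filtration F ->
    brownian_motion P F W ->
    admissible_drift P F b ->
    admissible_volatility sigma ->
    ito_process P W b sigma X ->
    (0 < n)%N ->
    0 < h -> h <= 1 ->
    n%:R * h \is a Num.nat ->
    h^-1 \is a Num.nat ->
    (r < d)%N ->
    beta_b <= 1 -> beta_Sigma <= beta_b -> 0 < beta_Sigma ->
    0 <= L_b -> 0 < L_Sigma ->
    (H0 P F r beta_b beta_Sigma L_b L_Sigma (spot_cov sigma) b ->
     ('E_P[test_stat X n h r]
       <= (K * (h `^ beta_Sigma
                * (L_Sigma + L_b ^+ 2 * n%:R^-1 * h `^ beta_b)))%:E)%E)
    /\
    (forall lam : R, 0 < lam ->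
     H0_gap P F r beta_b beta_Sigma L_b L_Sigma lam (spot_cov sigma) b ->
     ('E_P[test_stat X n h r]
       <= (K * (h `^ (2 * beta_Sigma)
                * (lam^-1 * L_Sigma ^+ 2 + L_b ^+ 2 * n%:R^-1)))%:E)%E).

Proof.
set nv := fine (@normal_variance R).
have nv0 : 0 <= nv by rewrite fine_ge0 // normal_variance_ge0.
(* 12 nv and 2 are the coefficients in [C]; the final 1 makes the constant positive also for d =
   0. *)
exists (d%:R * (12 * nv + 2) + 1).
  by rewrite ltr_wpDl // mulr_ge0 // addr_ge0 // mulr_ge0.
move=> disp Omega P F m W b sigma X n h r beta_b beta_Sigma L_b L_Sigma.
move=> filF bmW _ volS itoX n0 h0 h1 nhN hVN rd bb1 bSb bS0 Lb0 LS0.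
have bb0 := lt_le_trans bS0 bSb.
have hb_le : h `^ beta_b <= h `^ beta_Sigma by apply: ger_powR => //; rewrite h0.
have pS0 : 0 <= h `^ beta_Sigma by exact: powR_ge0.
have pb0 : 0 <= h `^ beta_b by exact: powR_ge0.
have nV0 : 0 <= n%:R^-1 :> R by rewrite invr_ge0.
have dR0 : 0 <= d%:R :> R by [].
have holder_le t s : holder_cov beta_Sigma L_Sigma (spot_cov sigma) ->
    0 <= t -> t <= s -> s <= 1 -> s - t <= h ->
    spectral_norm (spot_cov sigma s - spot_cov sigma t) <= L_Sigma * h `^ beta_Sigma.
  move=> [_ H] t0 ts s1 sth.
  apply: le_trans (H t s _ _) _.
  - by rewrite t0 (le_trans ts).
  - by rewrite s1 (le_trans t0).
  rewrite ler_wpM2l ?(ltW LS0) // ger0_norm ?subr_ge0 //.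
  by apply: ge0_ler_powR; rewrite ?nnegrE ?subr_ge0 ?(ltW bS0) ?(ltW h0).
have enorm_le1 (v : 'cV[R]_d) : sqn v <= 1 -> enorm v <= 1.
  by rewrite -enorm_sqr expr_le1 // enorm_ge0.
split=> [[_ Hb rk HS]|lam lam0 [[_ Hb rk HS] Hgap]].
  have K0 : 0 <= L_Sigma * h `^ beta_Sigma by rewrite mulr_ge0 // ltW.
  have kerS t s v : 0 <= t -> t <= s -> s <= 1 -> s - t <= h ->
      sqn v <= 1 -> spot_cov sigma t *m v = 0 ->
      qform (spot_cov sigma s) v <= L_Sigma * h `^ beta_Sigma.
    move=> t0 ts s1 sth v1 Sv.
    by apply: (qform_ker_le (spot_cov sigma t)); rewrite ?enorm_le1 ?holder_le.
  apply: le_trans (expectation_test_stat_le filF bmW volS itoX beta_b L_b Hb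
    bb0 Lb0 n h r _ n0 h0 nhN hVN rd rk K0 kerS) _.
  rewrite lee_fin -/nv.
  have -> : 12 * nv * (L_Sigma * h `^ beta_Sigma) +
      2 * (L_b * h `^ beta_b) ^+ 2 * n%:R^-1 =
      12 * nv * (h `^ beta_Sigma * L_Sigma) +
      2 * (h `^ beta_b * (L_b ^+ 2 * n%:R^-1 * h `^ beta_b)) by ring.
  (* Only one of the two factors [h^beta_b] is weakened to [h^beta_Sigma] here; in the gap case both
     are. *)
  rewrite [h `^ _ * (_ + _)]mulrDr; apply: weighted_sum_le => //.
  - by rewrite mulrC.
  - by rewrite !mulr_ge0 // sqr_ge0.
  - by rewrite ler_wpM2r // !mulr_ge0 // sqr_ge0.
have K0 : 0 <= lam^-1 * (L_Sigma * h `^ beta_Sigma) ^+ 2.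
  by rewrite mulr_ge0 ?sqr_ge0 // invr_ge0 ltW.
have kerS t s v : 0 <= t -> t <= s -> s <= 1 -> s - t <= h ->
    sqn v <= 1 -> spot_cov sigma t *m v = 0 ->
    qform (spot_cov sigma s) v <= lam^-1 * (L_Sigma * h `^ beta_Sigma) ^+ 2.
  move=> t0 ts s1 sth v1 Sv.
  have s01 : 0 <= s <= 1 by rewrite s1 (le_trans t0).
  (* After multiplication by lam, the form is compared through [eigval_gap] at time s with the
     squared length of [spot_cov sigma s *m v]. *)
  rewrite -(ler_pM2l lam0) mulrA mulfV ?gt_eqF // mul1r.
  apply: le_trans (eigval_gap (r := r) _ _ v _ _ lam0 _) _.
  - by have [psdS _] := HS; exact: psdS.
  - by rewrite rk // rd.
  - by move=> r0; exact: Hgap.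
  - by apply: (sqn_ker_le (spot_cov sigma t)); rewrite ?enorm_le1 ?holder_le.
apply: le_trans (expectation_test_stat_le filF bmW volS itoX beta_b L_b Hb
  bb0 Lb0 n h r _ n0 h0 nhN hVN rd rk K0 kerS) _.
rewrite lee_fin -/nv (mulrC 2 beta_Sigma) powRrM powR_mulrn //.
have -> : 12 * nv * (lam^-1 * (L_Sigma * h `^ beta_Sigma) ^+ 2) +
    2 * (L_b * h `^ beta_b) ^+ 2 * n%:R^-1 =
    12 * nv * ((h `^ beta_Sigma) ^+ 2 * (lam^-1 * L_Sigma ^+ 2)) +
    2 * ((h `^ beta_b) ^+ 2 * (L_b ^+ 2 * n%:R^-1)) by ring.
rewrite [(h `^ _) ^+ 2 * (_ + _)]mulrDr; apply: weighted_sum_le => //.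
- by rewrite mulr_ge0 ?sqr_ge0 // mulr_ge0 ?sqr_ge0 // invr_ge0 ltW.
- by rewrite mulr_ge0 ?sqr_ge0 // mulr_ge0 ?sqr_ge0.
- by rewrite ler_wpM2r ?ler_pXn2r ?nnegrE // mulr_ge0 ?sqr_ge0.
Qed.
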